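(* There is an absolute constant $C>0$ such that for all integers $N,T\ge 1$ and every real $D\ge 0$ there is an online algorithm for the $N$-experts $D$-switching cost problem with time horizon $T$, with $O(N\log T)$ computation per round, whose regret on every time interval $I\subseteq [T]=\{1,\dots,T\}$ is at most $C\sqrt{(D+1)\,|I|\,\log(NT)}$.
   Context: $N$-experts $D$-switching cost problem: there are $T$ time steps, $T$ known in advance. At time $t=1,\dots,T$ the (possibly randomized) online algorithm chooses an expert $i_t\in\{1,\dots,N\}$, based only on $l_1,\dots,l_{t-1}$ and its own randomness; then the loss vector $l_t=(l_t(1),\dots,l_t(N))\in[0,1]^N$ is revealed. The algorithm pays $l_t(i_t)$, plus a switching cost $D$ if $t\ge 2$ and $i_t\neq i_{t-1}$. The adversary is oblivious: the loss sequence is fixed before the first step. Time interval: a set $I=\{t_0+1,\dots,t_0+k\}\subseteq\{1,\dots,T\}$ of consecutive time steps, $|I|=k$. Regret on $I$: the smallest number $R(I)$ such that for every loss sequence $$\mathbb{E}\Big[\sum_{t\in I} l_t(i_t)+D\sum_{t\in I\setminus\{t_0+1\}}1[i_t\ne i_{t-1}]\Big]\le \min_{i\in\{1,\dots,N\}}\sum_{t\in I} l_t(i)+R(I),$$ the expectation being over the algorithm's randomness. Computation model: arithmetic operations, exponentiation, evaluating the error function, and sampling uniformly from $[0,1]$ each cost $O(1)$. *)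

(* Defs.v *)
From HB Require Import structures.
From mathcomp Require Import all_boot all_order all_algebra.
From mathcomp Require Import all_classical all_reals all_analysis.

Set Implicit Arguments.
Unset Strict Implicit.
Unset Printing Implicit Defensive.

Import Order.TTheory GRing.Theory Num.Theory.
Import numFieldNormedType.Exports.

Local Open Scope classical_set_scope.
Local Open Scope ring_scope.

Definition erf (R : realType) (x : R) : R :=
  Num.sg x * (2 / Num.sqrt pi *
    (\int[lebesgue_measure]_(t in `[0, `|x|]) expR (- t ^+ 2))%R).

(** * Real RAM

   Programs are finite and contain no real constants, so one program serves
   all N, T, D. There are two random access memories, one of natural numbers
   (used for indices) and one of real numbers, both initially 0 and addressed
   by natural numbers; both survive from one round to the next. No operation
   rounds a real number to an integer. *)

Inductive nexp : Type :=
  | NLit of nat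
  | NExperts
  | NHorizon
  | NMem of nexp
  | NAdd of nexp & nexp
  | NSub of nexp & nexp
  | NMul of nexp & nexp
  | NDiv of nexp & nexp.

(* [RLoss j] reads the [j]-th coordinate of the loss vector revealed last. *)
Inductive rexp : Type :=
  | RNat of nexp
  | RSwitch
  | RLoss of nexp
  | RMem of nexp
  | RAdd of rexp & rexp
  | RSub of rexp & rexp
  | RMul of rexp & rexp
  | RDiv of rexp & rexp
  | RExp of rexp
  | RPow of rexp & rexp
  | RErf of rexp.

Inductive test : Type :=
  | TNat of nexp & nexp
  | TReal of rexp & rexp.

(* [While n b c] repeats [c] as long as [b] holds, but at most [n] times, [n]
   being evaluated on entry. This keeps the semantics total; it loses nothing
   for programs whose running time is bounded in terms of N and T. *)
Inductive cmd : Type :=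
  | Skip
  | NSet of nexp & nexp
  | RSet of nexp & rexp
  | Sample of nexp
  | Seq of cmd & cmd
  | If of test & cmd & cmd
  | While of nexp & test & cmd.

Fixpoint ncost (e : nexp) : nat :=
  match e with
  | NLit _ | NExperts | NHorizon => 1
  | NMem a => (ncost a).+1
  | NAdd a b | NSub a b | NMul a b | NDiv a b => (ncost a + ncost b).+1
  end%N.

Fixpoint rcost (e : rexp) : nat :=
  match e with
  | RSwitch => 1
  | RNat a | RLoss a | RMem a => (ncost a).+1
  | RExp a | RErf a => (rcost a).+1
  | RAdd a b | RSub a b | RMul a b | RDiv a b | RPow a b =>
      (rcost a + rcost b).+1
  end%N.

Definition tcost (b : test) : nat :=
  match b with
  | TNat x y => (ncost x + ncost y).+1
  | TReal x y => (rcost x + rcost y).+1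
  end%N.

(* [in_coin k] is the result of the [k]-th call to the random generator,
   counted from the beginning of the first round. *)
Record inputs (R : realType) := Inputs {
  in_experts : nat;
  in_horizon : nat;
  in_switch : R;
  in_loss : nat -> R;
  in_coin : nat -> R
}.

(* [coins] counts the random numbers drawn so far, [clock] the elementary
   operations of the current round; programs can read neither. *)
Record state (R : realType) := State {
  nmem : nat -> nat;
  rmem : nat -> R;
  coins : nat;
  clock : nat
}.

Definition initial_state (R : realType) : state R :=
  State (fun=> 0%N) (fun=> 0) 0 0.

Definition tick (R : realType) (k : nat) (s : state R) : state R :=
  State (nmem s) (rmem s) (coins s) (clock s + k)%N.

Definition reset_clock (R : realType) (s : state R) : state R :=
  State (nmem s) (rmem s) (coins s) 0.

Definition upd (V : Type) (m : nat -> V) (i : nat) (v : V) : nat -> V :=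
  fun j => if j == i then v else m j.

Fixpoint neval (R : realType) (I : inputs R) (s : state R) (e : nexp) : nat :=
  match e with
  | NLit n => n
  | NExperts => in_experts I
  | NHorizon => in_horizon I
  | NMem a => nmem s (neval I s a)
  | NAdd a b => neval I s a + neval I s b
  | NSub a b => neval I s a - neval I s b
  | NMul a b => neval I s a * neval I s b
  | NDiv a b => neval I s a %/ neval I s b
  end%N.

Fixpoint reval (R : realType) (I : inputs R) (s : state R) (e : rexp) : R :=
  match e with
  | RNat a => (neval I s a)%:R
  | RSwitch => in_switch I
  | RLoss a => in_loss I (neval I s a)
  | RMem a => rmem s (neval I s a)
  | RAdd a b => reval I s a + reval I s b
  | RSub a b => reval I s a - reval I s b
  | RMul a b => reval I s a * reval I s b
  | RDiv a b => reval I s a / reval I s b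
  | RExp a => expR (reval I s a)
  | RPow a b => reval I s a `^ reval I s b
  | RErf a => erf (reval I s a)
  end.

Definition teval (R : realType) (I : inputs R) (s : state R) (b : test) : bool :=
  match b with
  | TNat x y => (neval I s x <= neval I s y)%N
  | TReal x y => reval I s x <= reval I s y
  end.

Fixpoint repeat_while (R : realType) (k n : nat) (b : state R -> bool)
    (f : state R -> state R) (s : state R) : state R :=
  if n is n'.+1 then
    let s' := tick k s in
    if b s' then repeat_while k n' b f (f s') else s'
  else s.

Fixpoint exec (R : realType) (I : inputs R) (c : cmd) (s : state R) : state R :=
  match c with
  | Skip => tick 1 s
  | NSet a e =>
      State (upd (nmem s) (neval I s a) (neval I s e)) (rmem s) (coins s)
            (clock s + (ncost a + ncost e).+1)%N
  | RSet a e =>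
      State (nmem s) (upd (rmem s) (neval I s a) (reval I s e)) (coins s)
            (clock s + (ncost a + rcost e).+1)%N
  | Sample a =>
      State (nmem s) (upd (rmem s) (neval I s a) (in_coin I (coins s)))
            (coins s).+1 (clock s + (ncost a).+1)%N
  | Seq c1 c2 => exec I c2 (exec I c1 s)
  | If b c1 c2 =>
      exec I (if teval I s b then c1 else c2) (tick (tcost b).+1 s)
  | While n b c =>
      repeat_while (tcost b).+1 (neval I s n) (fun s' => teval I s' b)
                   (exec I c) (tick (ncost n).+1 s)
  end.

(** * The experts problem with switching costs

   Experts are numbered from 0, time steps from 1; values of a loss sequence
   outside the time steps 1, ..., T play no role. *)

Definition loss_sequence (R : realType) (N T : nat) (l : nat -> 'I_N -> R) : Prop :=
  forall t i, (1 <= t <= T)%N -> 0 <= l t i <= 1.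

(* The loss vector seen by a program after [t] complete rounds. *)
Definition last_loss (R : realType) (N : nat) (l : nat -> 'I_N -> R) (t : nat)
    : nat -> R :=
  fun j => if t is 0 then 0 else if insub j is Some i then l t i else 0.

(* The state after [t] rounds. The whole program is executed in every round;
   in round [t.+1] it has access to the loss vector of step [t]. *)
Fixpoint run (R : realType) (A : cmd) (N T : nat) (D : R) (l : nat -> 'I_N -> R)
    (u : nat -> R) (t : nat) : state R :=
  if t is t'.+1 then
    exec (Inputs N T D (last_loss l t') u) A (reset_clock (run A T D l u t'))
  else initial_state R.

(* The expert chosen in round [t] is in cell 0 of the memory of natural numbers
   at the end of the round; numbers that are not experts stand for expert 0. *)
Definition chosen_expert (R : realType) (A : cmd) (N : nat) (hN : (0 < N)%N)
    (T : nat) (D : R) (l : nat -> 'I_N -> R) (u : nat -> R) (t : nat) : 'I_N :=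
  insubd (Ordinal hN) (nmem (run A T D l u t) 0).

Definition round_time (R : realType) (A : cmd) (N T : nat) (D : R)
    (l : nat -> 'I_N -> R) (u : nat -> R) (t : nat) : nat :=
  clock (run A T D l u t).

(* Cost of playing [x] on the interval t0+1, ..., t0+k. *)
Definition interval_cost (R : realType) (N : nat) (D : R) (l : nat -> 'I_N -> R)
    (x : nat -> 'I_N) (t0 k : nat) : R :=
  \sum_(t0 + 1 <= t < t0 + k + 1) l t (x t)
  + D * \sum_(t0 + 2 <= t < t0 + k + 1) (x t != x t.-1)%:R.

(* [x l w] is the sequence of experts played against the losses [l] when the
   outcome of the randomization is [w]. For the sequences produced by programs
   the cost is a measurable function of [w], since all the operations and tests
   of a program are Borel. *)
Definition regret (R : realType) (N : nat) (d : measure_display)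
    (W : measurableType d) (P : probability W R) (T : nat) (D : R)
    (x : (nat -> 'I_N -> R) -> W -> nat -> 'I_N) (t0 k : nat) : \bar R :=
  ereal_inf [set r%:E | r in [set r : R |
    forall l : nat -> 'I_N -> R, loss_sequence T l ->
      ('E_P[fun w => interval_cost D l (x l w) t0 k] <=
       \big[mine/+oo]_(i < N) (\sum_(t0 + 1 <= t < t0 + k + 1) l t i)%:E
       + r%:E)%E]].

Definition iid_uniform01 (R : realType) (d : measure_display)
    (W : measurableType d) (P : probability W R) (U : nat -> {RV P >-> R}) : Prop :=
  forall (n : nat) (B : nat -> set R), (forall j, measurable (B j)) ->
    P (\bigcap_(j in `I_n) (U j @^-1` B j)) =
    (\prod_(j < n) uniform_prob (@ltr01 R) (B j))%E.

(* Main.v *)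
Require Import Defs.
From HB Require Import structures.
From mathcomp Require Import all_boot all_order all_algebra.
From mathcomp Require Import all_classical all_reals all_analysis.
From mathcomp Require Import measurable_realfun.
From mathcomp Require Import ring lra zify.

Set Implicit Arguments.
Unset Strict Implicit.
Unset Printing Implicit Defensive.

Import Order.TTheory GRing.Theory Num.Theory.
Import numFieldNormedType.Exports.

Local Open Scope classical_set_scope.
Local Open Scope ring_scope.

(* Play is organised in about [log2 T] levels, from coarse to fine. A level with
   rate [eta] keeps weights [q] of total mass at most 1 and, on top of the
   distribution [P] produced by the coarser levels, plays the mixture
   [q + (1 - |q|) P]. After a round with losses [l], [q i] is multiplied by
   [1 + eta (<l, P> - l i - kappa)], receives the share [eta / (N T)], and [q] is
   scaled back if its mass exceeds 1. As the gain of the mixture over [P] is what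
   [|q|] grows by, up to the factor [eta], the regret against [P] telescopes to at
   most [O(1 / eta)], without any term in the length of the interval; the penalty
   [kappa = 4 D eta] makes this include the cost of moving [q]. With the potential
   [(|q| - ln (q i)) / eta] the regret against expert [i] on an interval of length
   [k] is [O(ln (N T) / eta + (D + 1) eta k)]. The rates double from one level to
   the next, so the [O(1 / eta)] terms of the levels finer than the one suited to
   [k] sum to a geometric series, and so do the movements of the coarser ones. The
   expert is drawn from the resulting distribution by updating the previous draw
   with a maximal coupling, so it switches with the probability given by the total
   variation distance between consecutive distributions. *)

(** * A single level *)

Section OneLevel.
Variables (R : realType) (N : nat).
Implicit Types (l P q : nat -> R) (eta kappa share : R).

Definition mass q : R := \sum_(i < N) q i.

Definition avg l P : R := \sum_(i < N) l i * P i.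

Definition mix q P : nat -> R := fun i => q i + (1 - mass q) * P i.

Definition raw_weights eta kappa share l P q : nat -> R :=
  fun i => q i * (1 + eta * (avg l P - l i - kappa)) + share.

Definition new_weights eta kappa share l P q : nat -> R :=
  let v := raw_weights eta kappa share l P q in
  fun i => v i / Num.max 1 (mass v).

Definition distr P := (forall i, 0 <= P i) /\ mass P = 1.

Definition subdistr q := (forall i, 0 <= q i) /\ mass q <= 1.

Definition l1dist (P Q : nat -> R) : R := \sum_(i < N) `|P i - Q i|.

Lemma mass_ge0 q : (forall i, 0 <= q i) -> 0 <= mass q.
Proof. by move=> q0; apply: sumr_ge0 => i _. Qed.

Lemma le_mass q (i : 'I_N) : (forall i, 0 <= q i) -> q i <= mass q.
Proof.
by move=> q0; rewrite /mass (bigD1 i)//= lerDl; apply: sumr_ge0 => j _.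
Qed.

Lemma mass_mix q P : mass P = 1 -> mass (mix q P) = 1.
Proof.
move=> P1; rewrite /mass big_split /= -mulr_sumr -/(mass q) -/(mass P) P1.
by rewrite mulr1 addrC subrK.
Qed.

Lemma distr_mix q P : subdistr q -> distr P -> distr (mix q P).
Proof.
move=> [q0 q1] [P0 P1]; split; last exact: mass_mix.
by move=> i; rewrite addr_ge0// mulr_ge0// subr_ge0.
Qed.

Lemma avg_mix l q P : avg l (mix q P) = avg l q + (1 - mass q) * avg l P.
Proof.
rewrite /avg /mix mulr_sumr -big_split /=; apply: eq_bigr => i _.
by ring.
Qed.

Lemma avg_ge0 l P : (forall i, 0 <= l i) -> (forall i, 0 <= P i) -> 0 <= avg l P.
Proof. by move=> l0 P0; apply: sumr_ge0 => i _; rewrite mulr_ge0. Qed.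

Lemma avg_le_mass l q : (forall i, l i <= 1) -> (forall i, 0 <= q i) ->
  avg l q <= mass q.
Proof. by move=> l1 q0; apply: ler_sum => i _; rewrite ler_piMl. Qed.

(** The identity behind the telescoping: per unit of [eta], the mass grows by the gain of the
    mixture over [P], up to the penalty and the shares. *)
Lemma mass_raw eta kappa share l P q :
  mass (raw_weights eta kappa share l P q) =
  mass q + eta * (avg l P - avg l (mix q P) - kappa * mass q) + N%:R * share.
Proof.
rewrite avg_mix /mass /raw_weights big_split /= sumr_const card_ord.
rewrite -[share *+ N]mulr_natl; congr (_ + _).
transitivity (\sum_(i < N) (q i + eta * (avg l P - kappa) * q i
  - eta * (l i * q i))).
  by apply: eq_bigr => i _; ring.
rewrite !big_split /= sumrN -!mulr_sumr -/(avg l q) -/(mass q).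
by ring.
Qed.

(** * One update of a level; [eta * rho] is the total of the shares handed out *)

Section Step.
Variables (eta kappa share rho : R) (l P q : nat -> R).
Hypothesis eta0 : 0 < eta.
Hypothesis eta4 : eta <= 1 / 4.
Hypothesis kappa01 : 0 <= kappa <= 1.
Hypothesis share0 : 0 <= share.
Hypothesis Nshare : N%:R * share = eta * rho.
Hypothesis rho01 : 0 <= rho <= 1.
Hypothesis l01 : forall i, 0 <= l i <= 1.
Hypothesis Pdistr : distr P.
Hypothesis qsub : subdistr q.

Let v := raw_weights eta kappa share l P q.
Let q' := new_weights eta kappa share l P q.
Let c := avg l P.

Lemma avg01 : 0 <= avg l P <= 1.
Proof.
have [P0 P1] := Pdistr; apply/andP; split.
  by apply: avg_ge0 => // i; have /andP[] := l01 i.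
by rewrite -P1; apply: avg_le_mass => // i; have /andP[] := l01 i.
Qed.

(** [c], [l i] and [kappa] lie in [0, 1], so the bracket is at most 2 in absolute value. With
    [eta <= 1/4] the factor stays at least 1/2, which keeps the weights nonnegative and permits a
    second-order bound on its logarithm. *)
Lemma growth_bounds i :
  1 - 2 * eta <= 1 + eta * (c - l i - kappa) <= 1 + 2 * eta.
Proof.
have e0 := eta0; have e4 := eta4.
have /andP[c0 c1] := avg01; have /andP[l0 l1] := l01 i.
have /andP[k0 k1] := kappa01; rewrite -/c in c0 c1.
apply/andP; split; rewrite lerD2l; last first.
  by rewrite mulrC ler_wpM2r//; [exact: ltW | lra].
by rewrite -mulNr mulrC -subr_ge0 -mulrBr mulr_ge0//; [exact: ltW | lra].
Qed.

Lemma raw_ge0 i : 0 <= v i.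
Proof.
have e0 := eta0; have e4 := eta4.
have [q0 _] := qsub; rewrite /v /raw_weights addr_ge0// mulr_ge0//.
by have /andP[h _] := growth_bounds i; apply: le_trans h; lra.
Qed.

Let S := Num.max 1 (mass v).

Lemma scale_ge1 : 1 <= S. Proof. by rewrite /S le_max lexx. Qed.

Let S_gt0 : 0 < S. Proof. exact: lt_le_trans ltr01 scale_ge1. Qed.

(** The gain and the shares each add at most [eta <= 1/4] to a mass of at most 1. Rescaling
    therefore costs a weight at most a factor 2. *)
Lemma scale_le2 : S <= 2.
Proof.
have e0 := eta0; have e4 := eta4.
have [q0 q1] := qsub; have /andP[k0 k1] := kappa01.
have /andP[r0 r1] := rho01.
have [P0 P1] := Pdistr.
have s0 := mass_ge0 q0.
have /andP[c0 c1] := avg01.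
rewrite /S ge_max; apply/andP; split; first by lra.
rewrite /v mass_raw Nshare avg_mix.
have lq0 : 0 <= avg l q by apply: avg_ge0 => // i; have /andP[] := l01 i.
have : avg l P - (avg l q + (1 - mass q) * avg l P) - kappa * mass q <= 1.
  have -> : avg l P - (avg l q + (1 - mass q) * avg l P) - kappa * mass q =
     mass q * avg l P - avg l q - kappa * mass q by ring.
  have : 0 <= kappa * mass q by rewrite mulr_ge0.
  have : mass q * avg l P <= 1 by rewrite mulr_ile1.
  by lra.
move: (_ - _) => x x1.
have : eta * x <= eta by rewrite ger_pMr.
have : eta * rho <= eta by rewrite ger_pMr.
by lra.
Qed.

Lemma mass_new : mass q' = mass v / S.
Proof. by rewrite /q' /new_weights /mass -mulr_suml. Qed.

Lemma mass_new_le : mass q' <= mass v.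
Proof.
rewrite mass_new ler_pdivrMr// ler_peMr ?scale_ge1//.
by apply: mass_ge0; exact: raw_ge0.
Qed.

Lemma subdistr_new : subdistr q'.
Proof.
split=> [i|]; first by rewrite divr_ge0 ?raw_ge0// ltW.
by rewrite mass_new ler_pdivrMr// mul1r /S le_max lexx orbT.
Qed.

Lemma l1dist_raw : l1dist v q <= 2 * eta * mass q + eta * rho.
Proof.
have e0 := eta0; have e4 := eta4.
have [q0 _] := qsub.
have -> : 2 * eta * mass q + eta * rho = \sum_(i < N) (2 * eta * q i + share).
  by rewrite big_split /= sumr_const card_ord -mulr_sumr -Nshare -[share *+ N]mulr_natl.
apply: ler_sum => i _ /=.
rewrite /v /raw_weights -/c mulrDr mulr1 addrAC [q i + _]addrC addrK.
apply: (le_trans (ler_normD _ _)); rewrite (ger0_norm share0) lerD2r.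
rewrite normrM (ger0_norm (q0 i)) mulrC ler_wpM2r//.
have /andP[] := growth_bounds i.
by rewrite ler_norml; lra.
Qed.

(** Rescaling acts only if the raw mass exceeds 1, and then removes [mass v - 1 <= mass v - mass q].
    This is at most the distance from [q] to [v], so the bound for the raw weights doubles. *)
Lemma l1dist_new : l1dist q' q <= 4 * eta * mass q + 2 * eta * rho.
Proof.
have e0 := eta0; have e4 := eta4.
have [q0 q1] := qsub.
have H := l1dist_raw.
suff : l1dist q' q <= 2 * l1dist v q by lra.
have -> : 2 * l1dist v q = l1dist v q + l1dist v q by ring.
have : mass v - mass q' <= l1dist v q.
  rewrite mass_new /S.
  have vq : mass v - mass q <= l1dist v q.
    rewrite /mass -sumrB; apply: ler_sum => i _; exact: ler_norm.
  have vq0 : 0 <= l1dist v q by apply: sumr_ge0.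
  rewrite /Order.max; case: ltP => h; last by rewrite divr1 subrr.
  rewrite divff; last by rewrite gt_eqF// (lt_trans ltr01 h).
  by lra.
move=> h; apply: le_trans (_ : (mass v - mass q') + l1dist v q <= _).
  rewrite /mass -sumrB -big_split; apply: ler_sum => i _ /=.
  have : q' i <= v i.
    rewrite /q' /new_weights -/v -/S ler_pdivrMr// ler_peMr ?scale_ge1//.
    exact: raw_ge0.
  move=> qv.
  have -> : v i - q' i = `|q' i - v i| by rewrite distrC ger0_norm// subr_ge0.
  by rewrite -[q' i - q i](subrKA (v i)) addrC addrC ler_normD.
by rewrite lerD2r.
Qed.

(** Since rescaling only lowers the mass, [mass_raw] bounds the gain of [P] below. The choice of
    [kappa] makes the penalty pay exactly for the part [4 * eta * mass q] of the movement; the part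
    due to the shares costs [kappa * rho / 2] and goes into [2 * rho]. *)
Lemma regret_baseline (D : R) : 0 <= D -> kappa = 4 * D * eta ->
  avg l (mix q P) + D * (4 * eta * mass q + 2 * eta * rho) <=
  avg l P + (mass q - mass q') / eta + 2 * rho.
Proof.
have e0 := eta0; have e4 := eta4.
move=> D0 kD.
have := mass_new_le; rewrite /v mass_raw Nshare => h.
have /andP[k0 k1] := kappa01; have /andP[r0 r1] := rho01.
have e : D * (4 * eta * mass q + 2 * eta * rho) = kappa * mass q + kappa * rho / 2.
  by rewrite kD; field.
have kr : kappa * rho <= rho by rewrite ler_piMl.
suff : avg l (mix q P) + kappa * mass q <= avg l P + (mass q - mass q') / eta + rho.
  by lra.
have -> : avg l P + (mass q - mass q') / eta + rho =
  avg l P + rho + (mass q - mass q') / eta by ring.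
rewrite -lerBlDl ler_pdivlMr//.
by lra.
Qed.

Definition potential (q : nat -> R) i : R := (mass q - ln (q i)) / eta.

(** From [ln y <= y - 1] at [y = 1 / (1 + x)]; what then remains is [x^2 (1 + 2 x) >= 0]. *)
Lemma ln_sub_ge (x : R) : - (1 / 2) <= x -> x - 2 * x ^+ 2 <= ln (1 + x).
Proof.
move=> x2.
have x1 : 0 < 1 + x by lra.
have h : ln (1 + x)^-1 <= (1 + x)^-1 - 1.
  have e : 1 + ((1 + x)^-1 - 1) = (1 + x)^-1 by ring.
  rewrite -[in leLHS]e; apply: le_ln1Dx.
  by rewrite ltrBrDl subrr invr_gt0.
rewrite lnV ?posrE// in h.
suff : x - 2 * x ^+ 2 <= 1 - (1 + x)^-1 by lra.
have -> : 1 - (1 + x)^-1 = x / (1 + x) by field; lra.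
rewrite ler_pdivlMr// -subr_ge0.
have -> : x - (x - 2 * x ^+ 2) * (1 + x) = x ^+ 2 * (1 + 2 * x) by ring.
by rewrite mulr_ge0 ?sqr_ge0//; lra.
Qed.

(** With [x] the raw mass, this says that rescaling does not raise the potential: the drop in mass
    outweighs the drop in the logarithm of each weight. *)
Lemma ln_max1_le (x : R) : 0 <= x -> ln (Num.max 1 x) + x / Num.max 1 x <= x.
Proof.
move=> x0; rewrite /Order.max; case: ltP => h; last by rewrite ln1 add0r divr1.
rewrite divff; last by rewrite gt_eqF// (lt_trans ltr01 h).
by rewrite -lerBrDr -{1}[x](subrKC 1) le_ln1Dx// ltrBrDl subrr (lt_trans ltr01 h).
Qed.

(** The mass part of the potential changes by about [c - avg l (mix q P)], the logarithmic part by
    about [g = c - l i - kappa]. In the difference [c] cancels, leaving the regret against [i]; the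
    second-order error [2 * eta * g^2] is at most [8 * eta] because [|g| <= 2]. *)
Lemma regret_expert (i : 'I_N) : 0 < q i ->
  avg l (mix q P) <=
  l i + potential q i - potential q' i + 8 * eta + kappa + rho.
Proof.
have e0 := eta0; have e4 := eta4.
have [q0 q1] := qsub; have k01 := kappa01; have r01 := rho01.
move=> qi0.
have m0 := mass_ge0 q0.
have /andP[b1 b2] := growth_bounds i.
have l01i := l01 i; have c01 := avg01.
set g := c - l i - kappa in b1 b2.
have g2 : g ^+ 2 <= 4.
  have -> : 4 = 2 ^+ 2 :> R by ring.
  by rewrite -real_normK ?num_real// ler_sqr ?nnegrE// ler_norml /g /c; lra.
have x2 : - (1 / 2) <= eta * g by lra.
have L1 := ln_sub_ge x2.
have p1 : 0 < 1 + eta * g by lra.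
have vi : q i * (1 + eta * g) <= v i by rewrite /v /raw_weights lerDl.
have v0 : 0 < v i by apply: lt_le_trans vi; rewrite mulr_gt0.
have L2 : ln (q i) + ln (1 + eta * g) <= ln (v i).
  by rewrite -lnM ?posrE// ler_ln ?posrE// mulr_gt0.
have L3 : ln (q' i) = ln (v i) - ln S by rewrite ln_div ?posrE.
have L4 := ln_max1_le (mass_ge0 raw_ge0).
rewrite -/S -mass_new in L4.
have L5 : mass v = mass q + eta * (c - avg l (mix q P) - kappa * mass q) + eta * rho.
  by rewrite /v mass_raw Nshare.
have -> : l i + potential q i - potential q' i + 8 * eta + kappa + rho =
  (mass q - ln (q i) - (mass q' - ln (q' i))) / eta
   + (l i + 8 * eta + kappa + rho).
  by rewrite /potential; ring.
rewrite -lerBlDr ler_pdivlMr// L3.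
have L6 : eta * (eta * g ^+ 2) <= eta * (eta * 4) by rewrite !ler_wpM2l// ltW.
have L7 : 0 <= eta * (kappa * mass q).
  by rewrite !mulr_ge0//; [exact: ltW | lra].
rewrite exprMn in L1.
have L8 : eta * g = eta * c - eta * l i - eta * kappa by rewrite /g; ring.
by lra.
Qed.

(** The share is added before the scaling, which divides by at most 2. This bounds the potential at
    the start of any interval, whatever happened earlier. *)
Lemma new_weights_lb (i : 'I_N) : share / 2 <= q' i.
Proof.
have e0 := eta0; have e4 := eta4.
have [q0 q1] := qsub.
rewrite /q' /new_weights -/v -/S ler_pdivlMr//.
have : share <= v i.
  rewrite /v /raw_weights lerDr mulr_ge0//.
  by have /andP[h _] := growth_bounds i; apply: le_trans h; lra.
apply: le_trans; rewrite mulrAC -mulrA ler_piMr// ler_pdivrMr// mul1r.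
exact: scale_le2.
Qed.

End Step.

End OneLevel.

(** * The levels together *)

Section AllLevels.
Variables (R : realType) (N T : nat) (D : R) (ell : nat -> nat -> R).

Definition levels : nat := (trunc_log 2 T).+1.

(** Normalised so that the finest level, [levels - 1], has rate [1 / (4 (D + 1))]. Then all rates
    are at most 1/4 and all penalties at most 1. *)
Definition rate (d : nat) : R := 1 / (2 * (D + 1) * (2 ^ levels)%:R) * 2 ^+ d.

Definition penalty d : R := 4 * D * rate d.

Definition share d : R := rate d / (N * T)%:R.

(** The mixture of the levels below [d], built on the point mass at expert 0. *)
Fixpoint dist (q : nat -> nat -> R) (d : nat) : nat -> R :=
  if d is d'.+1 then mix N (q d') (dist q d') else fun i => (i == 0%N)%:R.

Definition next_weights (l : nat -> R) (q : nat -> nat -> R) (d : nat) :=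
  new_weights N (rate d) (penalty d) (share d) l (dist q d) (q d).

(** These are the weights in force at step [t]. They start from 0, and the update with [ell 0], made
    before step 1, hands every expert its first share. *)
Fixpoint weights (t : nat) : nat -> nat -> R :=
  if t is t'.+1 then next_weights (ell t') (weights t') else fun _ _ => 0.

Definition play t := dist (weights t) levels.

Let q t d := weights t d.
Let p t d := dist (weights t) d.

(** The bound of [l1dist_new] with [rho = 1 / T]. It is charged in place of the actual distance
    since this is the form that the penalty offsets in [regret_baseline]. *)
Definition movement t d : R :=
  4 * rate d * mass N (q t d) + 2 * rate d * (1 / T%:R).

Hypotheses (N_gt0 : (0 < N)%N) (T_gt0 : (0 < T)%N) (D_ge0 : 0 <= D).
Hypothesis ell01 : forall t i, 0 <= ell t i <= 1.

Lemma rateS d : rate d.+1 = 2 * rate d.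
Proof. by rewrite /rate exprS mulrCA. Qed.

Let D1_gt0 : 0 < D + 1. Proof. by rewrite ltr_wpDl. Qed.

Let H_gt0 : 0 < (2 ^ levels)%:R :> R. Proof. by rewrite ltr0n expn_gt0. Qed.

Lemma rate_gt0 d : 0 < rate d.
Proof.
by rewrite /rate div1r mulr_gt0 ?exprn_gt0// invr_gt0 mulr_gt0// mulr_gt0.
Qed.

Lemma rate_level s : (s < levels)%N ->
  rate (levels - s.+1) = 1 / (4 * (D + 1) * 2 ^+ s).
Proof.
move=> sL; rewrite /rate natrX -(subnK sL) addnK exprD exprS.
have D1 := lt0r_neq0 D1_gt0.
by field; rewrite D1 !expf_neq0.
Qed.

Lemma rate_le d : (d < levels)%N -> rate d <= 1 / (4 * (D + 1)).
Proof.
move=> dL; have -> : d = (levels - (levels - d.+1).+1)%N by lia.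
rewrite rate_level; last lia.
rewrite !div1r lef_pV2 ?posrE ?mulr_gt0 ?exprn_gt0//.
have e1 : 1 <= 2 ^+ (levels - d.+1) :> R by rewrite exprn_ege1// ler1n.
by apply: ler_peMr => //; rewrite mulr_ge0// ltW.
Qed.

Lemma rate_le4 d : (d < levels)%N -> rate d <= 1 / 4.
Proof.
move=> dL; apply: le_trans (rate_le dL) _.
have D0 := D_ge0.
by rewrite !div1r lef_pV2 ?posrE ?mulr_gt0// ler_pMr//; lra.
Qed.

Lemma penalty01 d : (d < levels)%N -> 0 <= penalty d <= 1.
Proof.
move=> dL; have r0 := rate_gt0 d; have D0 := D_ge0.
have := rate_le dL; rewrite ler_pdivlMr ?mulr_gt0// => r1.
have Dr : 0 <= D * rate d by rewrite mulr_ge0// ltW.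
by rewrite /penalty; apply/andP; split; lra.
Qed.

Lemma share_gt0 d : 0 < share d.
Proof. by rewrite divr_gt0 ?rate_gt0// ltr0n muln_gt0 N_gt0. Qed.

Lemma share_ge0 d : 0 <= share d. Proof. exact/ltW/share_gt0. Qed.

Lemma share_sum d : N%:R * share d = rate d * (1 / T%:R).
Proof.
rewrite /share natrM; field.
by rewrite !pnatr_eq0 -!lt0n N_gt0 T_gt0.
Qed.

Lemma rho01 : 0 <= (1 / T%:R : R) <= 1.
Proof. by rewrite divr_ge0//= ler_pdivrMr ?ltr0n// mul1r ler1n. Qed.

Lemma distr_dist (w : nat -> nat -> R) :
  (forall d, (d < levels)%N -> subdistr N (w d)) ->
  forall d, (d <= levels)%N -> distr N (dist w d).
Proof.
move=> ws; elim=> [_|d IH dL]; last first.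
  by apply: distr_mix; [exact: ws | apply: IH; exact: ltnW].
split=> [i|]; first exact: ler0n.
rewrite /mass (bigD1 (Ordinal N_gt0))//= big1 ?addr0// => i.
by rewrite -val_eqE /= => /negbTE ->.
Qed.

Lemma subdistr_weights t d : (d < levels)%N -> subdistr N (q t d).
Proof.
elim: t d => [|t IH] d dL; first by split=> //; rewrite /mass big1.
apply: (subdistr_new (rate_gt0 d)).
- exact: rate_le4.
- exact: penalty01.
- exact: share_ge0.
- by [].
- by apply: distr_dist => //; exact: ltnW.
- exact: IH.
Qed.

Lemma distr_weights t d : (d <= levels)%N -> distr N (p t d).
Proof. by apply: distr_dist => e; exact: subdistr_weights. Qed.

Definition cost t d : R := avg N (ell t) (p t d).

Lemma movement_ge0 t d : (d < levels)%N -> 0 <= movement t d.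
Proof.
move=> /(subdistr_weights t) [q0 _]; have /andP[r0 _] := rho01.
have e0 := ltW (rate_gt0 d); have m0 := mass_ge0 N q0.
by apply: addr_ge0; apply: mulr_ge0 => //; rewrite mulr_ge0.
Qed.

Lemma movement_le t d : (d < levels)%N -> D * movement t d <= 8 * D * rate d.
Proof.
move=> /(subdistr_weights t) [q0 q1]; have /andP[r0 r1] := rho01.
have e0 := rate_gt0 d.
have -> : 8 * D * rate d = D * (8 * rate d) by ring.
rewrite ler_wpM2l// /movement.
have : rate d * mass N (q t d) <= rate d by rewrite ger_pMr.
have : rate d * (1 / T%:R) <= rate d by rewrite ger_pMr.
by lra.
Qed.

(** A change of the coarser distribution is damped by [1 - mass N Q <= 1]. A change of the weights
    counts twice, directly and through the mass left to [P']. *)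
Lemma l1dist_mix (P P' Q Q' : nat -> R) : distr N P' -> subdistr N Q ->
  l1dist N (mix N Q' P') (mix N Q P) <= l1dist N P' P + 2 * l1dist N Q' Q.
Proof.
move=> [P0 P1] [Q0 Q1].
have mQ : `|mass N Q' - mass N Q| <= l1dist N Q' Q.
  by rewrite /mass -sumrB ler_norm_sum.
apply: le_trans (_ : l1dist N Q' Q + `|mass N Q' - mass N Q| * mass N P'
   + l1dist N P' P <= _); last first.
  by rewrite P1 mulr1; lra.
rewrite [X in _ + X * _ + _]lock /mass mulr_sumr -!big_split /= -lock.
apply: ler_sum => i _; rewrite /mix.
have -> : Q' i + (1 - mass N Q') * P' i - (Q i + (1 - mass N Q) * P i) =
  Q' i - Q i - (mass N Q' - mass N Q) * P' i + (1 - mass N Q) * (P' i - P i).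
  by ring.
apply: le_trans (ler_normD _ _) _; apply: lerD.
  apply: le_trans (ler_normB _ _) _; apply: lerD => //.
  by rewrite normrM (ger0_norm (P0 i)).
rewrite normrM ger0_norm ?subr_ge0// ler_piMl//.
have : 0 <= mass N Q by exact: mass_ge0.
by lra.
Qed.

(** The factor 2 is harmless: an expert switches with at most half this distance as probability. *)
Lemma l1dist_dist t d : (d <= levels)%N ->
  l1dist N (p t.+1 d) (p t d) <= 2 * \sum_(j < d) movement t j.
Proof.
elim: d => [_|d IH dL].
  rewrite big_ord0 mulr0 /l1dist big1// => i _.
  by rewrite /p /= subrr normr0.
rewrite big_ord_recr /= mulrDr.
have sq := subdistr_weights t dL.
apply: le_trans (l1dist_mix _ _ (distr_weights t.+1 (ltnW dL)) sq) _.
apply: lerD; first by apply: IH; exact: ltnW.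
rewrite ler_wpM2l//.
apply: (l1dist_new (rate_gt0 d)) => //.
- exact: rate_le4.
- exact: penalty01.
- exact: share_ge0.
- exact: share_sum.
- by apply: distr_weights; exact: ltnW.
Qed.

Lemma cost_step t d : (d < levels)%N ->
  cost t d.+1 + D * movement t d <=
  cost t d + (mass N (q t d) / rate d - mass N (q t.+1 d) / rate d)
  + 2 * (1 / T%:R).
Proof.
move=> dL; rewrite -mulrBl.
apply: (regret_baseline (rate_gt0 d)) => //.
- exact: rate_le4.
- exact: penalty01.
- exact: share_ge0.
- exact: share_sum.
- exact: rho01.
- by apply: distr_weights; exact: ltnW.
- exact: subdistr_weights.
Qed.

(** * Regret of the levels over an interval *)

Lemma sum_telescope (f g h : nat -> R) (e : R) m k :
  (forall t, (m <= t < m + k)%N -> f t <= g t + (h t - h t.+1) + e) ->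
  \sum_(m <= t < m + k) f t <=
  \sum_(m <= t < m + k) g t + (h m - h (m + k)%N) + k%:R * e.
Proof.
elim: k => [_|k IH H].
  by rewrite addn0 !big_geq// subrr mul0r !addr0.
rewrite addnS !big_nat_recr ?leq_addr//=.
have := IH (fun t th => H t ltac:(lia)).
have := H (m + k)%N ltac:(lia).
rewrite -natr1 mulrDl mul1r.
by lra.
Qed.

(** The masses telescope to at most [1 / rate d]. The shares are scaled by [1 / T], so that over any
    [k <= T] steps they add at most 2, again within [2 / rate d]. *)
Lemma regret_one_level m k d : (k <= T)%N -> (d < levels)%N ->
  \sum_(m <= t < m + k) (cost t d.+1 + D * movement t d) <=
  \sum_(m <= t < m + k) cost t d + 3 / rate d.
Proof.
move=> kT dL; have e0 := rate_gt0 d.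
apply: le_trans (sum_telescope (fun t _ => cost_step t dL)) _.
rewrite -addrA lerD2l.
have [q0 q1] := subdistr_weights m dL.
have [q0' q1'] := subdistr_weights (m + k) dL.
have : mass N (q m d) / rate d <= 1 / rate d by rewrite ler_pM2r ?invr_gt0.
have : 0 <= mass N (q (m + k) d) / rate d by rewrite divr_ge0 ?mass_ge0// ltW.
have : 1 <= 1 / rate d.
  rewrite ler_pdivlMr// mul1r; apply: le_trans (rate_le4 dL) _.
  by rewrite ler_pdivrMr//; lra.
have : k%:R * (2 * (1 / T%:R)) <= 2 :> R.
  rewrite mulrCA ger_pMr// div1r ler_pdivrMr ?ltr0n// mul1r.
  by rewrite ler_nat.
have := rate_le4 dL; rewrite ler_pdivlMr// => r4.
have : 4 <= 1 / rate d by rewrite ler_pdivlMr//; lra.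
by lra.
Qed.

(** Each level is compared with the next coarser one, so the losses telescope down to level [d]
    while the movements of the levels passed are paid on the way. *)
Lemma regret_levels m k d n : (k <= T)%N -> (d + n <= levels)%N ->
  \sum_(m <= t < m + k) (cost t (d + n) + D * \sum_(d <= j < d + n) movement t j)
  <= \sum_(m <= t < m + k) cost t d + \sum_(d <= j < d + n) 3 / rate j.
Proof.
move=> kT; elim: n => [_|n IH nL].
  rewrite addn0 [X in _ <= _ + X]big_geq// addr0.
  by apply: ler_sum => t _; rewrite big_geq// mulr0 addr0.
rewrite addnS [X in _ <= _ + X]big_nat_recr ?leq_addr//= addrA.
have := regret_one_level m kT (ltac:(lia) : (d + n < levels)%N).
have := IH ltac:(lia).
rewrite !big_split /=.
under [X in _ -> _ -> _ + X <= _]eq_bigr => t _.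
  rewrite big_nat_recr ?leq_addr//= mulrDr.
  over.
rewrite big_split /=.
by lra.
Qed.

(** The potential is nonnegative at the end, as weights are at most 1, and at the start it is
    bounded through [q m d i >= share d / 2]. The latter needs [0 < m], since the weights at time 0
    vanish. The final 1 collects the shares. *)
Lemma regret_at_level m k (i : 'I_N) d : (0 < m)%N -> (k <= T)%N ->
  (d < levels)%N ->
  \sum_(m <= t < m + k) cost t d.+1 <=
  \sum_(m <= t < m + k) ell t i + (ln (2 * (N * T)%:R / rate d) + 1) / rate d
  + 8 * (D + 1) * rate d * k%:R + 1.
Proof.
move=> m0 kT dL; have e0 := rate_gt0 d.
have valid t : distr N (p t d) by apply: distr_weights; exact: ltnW.
have lb t : (0 < t)%N -> share d / 2 <= q t d i.
  case: t => // t _; apply: (new_weights_lb (rho := 1 / T%:R) e0) => //.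
  - exact: rate_le4.
  - exact: penalty01.
  - exact: share_ge0.
  - exact: share_sum.
  - exact: rho01.
  - exact: valid.
  - exact: subdistr_weights.
have s2 : 0 < share d / 2 by rewrite divr_gt0// share_gt0.
pose h t := potential N (rate d) (q t d) i.
have step t : (m <= t < m + k)%N ->
    cost t d.+1 <= ell t i + (h t - h t.+1)
      + (8 * rate d + penalty d + 1 / T%:R).
  move=> /andP[mt _]; rewrite !addrA.
  apply: (regret_expert e0) => //.
  - exact: rate_le4.
  - exact: penalty01.
  - exact: share_ge0.
  - exact: share_sum.
  - exact: rho01.
  - exact: valid.
  - exact: subdistr_weights.
  - by apply: lt_le_trans s2 _; apply: lb; lia.
apply: le_trans (sum_telescope step) _.
have hend : 0 <= h (m + k)%N.
  have [q0 q1] := subdistr_weights (m + k) dL.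
  rewrite /h /potential divr_ge0// ?(ltW e0)//.
  have := ln_le0 (le_trans (le_mass i q0) q1).
  by have := mass_ge0 N q0; rewrite subr_ge0 => ? /le_trans; exact.
have hstart : h m <= (ln (2 * (N * T)%:R / rate d) + 1) / rate d.
  rewrite /h /potential ler_pM2r ?invr_gt0//.
  have [q0 q1] := subdistr_weights m dL.
  have -> : 2 * (N * T)%:R / rate d = (share d / 2)^-1.
    have n0 : (N * T)%:R != 0 :> R by rewrite pnatr_eq0 -lt0n muln_gt0 N_gt0.
    rewrite /share; move: (_%:R : R) n0 => z z0.
    by field; rewrite z0 gt_eqF.
  rewrite lnV ?posrE//.
  have : ln (share d / 2) <= ln (q m d i).
    by rewrite ler_ln ?posrE ?(lt_le_trans s2) ?lb.
  by lra.
have kr : k%:R * (1 / T%:R) <= 1 :> R.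
  by rewrite mul1r ler_pdivrMr ?ltr0n// mul1r ler_nat.
have kp : k%:R * (8 * rate d + penalty d) <= 8 * (D + 1) * rate d * k%:R.
  rewrite mulrC ler_wpM2r// /penalty.
  have : 0 <= D * rate d by rewrite mulr_ge0// ltW.
  by lra.
by lra.
Qed.

Lemma sum_inv_rate d n :
  \sum_(d.+1 <= j < d.+1 + n) 3 / rate j <= 3 / rate d.
Proof.
(* Retaining the last term of the geometric series makes the bound inductive. *)
suff : \sum_(d.+1 <= j < d.+1 + n) 3 / rate j <= 3 / rate d - 3 / rate (d + n).
  have : 0 <= 3 / rate (d + n) by rewrite divr_ge0// ltW// rate_gt0.
  by lra.
elim: n => [|n IH]; first by rewrite !addn0 big_geq// subrr.
rewrite addnS big_nat_recr ?leq_addr//=.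
apply: le_trans (lerD IH (lexx _)) _.
rewrite addSn addnS rateS.
have e0 := rate_gt0 (d + n).
have -> : 3 / (2 * rate (d + n)) = 3 / rate (d + n) / 2.
  by field; rewrite gt_eqF.
by lra.
Qed.

Lemma sum_rate d : \sum_(0 <= j < d.+1) 8 * D * rate j <= 16 * D * rate d.
Proof.
elim: d => [|d IH].
  rewrite big_nat1 ler_wpM2r ?(ltW (rate_gt0 _))// ler_wpM2r//.
  by rewrite ler_nat.
rewrite big_nat_recr//= rateS; apply: le_trans (lerD IH (lexx _)) _.
by lra.
Qed.

Lemma sum_movement_le t d : (d < levels)%N ->
  D * \sum_(0 <= j < d.+1) movement t j <= 16 * D * rate d.
Proof.
move=> dL; apply: le_trans (sum_rate d); rewrite mulr_sumr.
rewrite !big_nat; apply: ler_sum => j jd.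
by apply: movement_le; lia.
Qed.

(** Dominates the expected loss at step [t] plus the expected cost of the switch from step [t] to
    step [t + 1]. *)
Definition total_cost t : R :=
  cost t levels + D * \sum_(0 <= j < levels) movement t j.

(** Level [d] competes with expert [i]. The finer levels lose at most [3 / rate d] against it, their
    movements included; the movements of level [d] and the coarser ones are bounded crudely by
    [16 * D * rate d] per step. *)
Lemma regret_scale m k (i : 'I_N) d : (0 < m)%N -> (k <= T)%N ->
  (d < levels)%N ->
  \sum_(m <= t < m + k) total_cost t <=
  \sum_(m <= t < m + k) ell t i + (ln (2 * (N * T)%:R / rate d) + 5) / rate d
  + 24 * (D + 1) * rate d * k%:R.
Proof.
move=> m0 kT dL.
have Le : (d.+1 + (levels - d.+1) = levels)%N by lia.
have H1 := regret_levels m kT (eq_leq Le).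
have H2 := regret_at_level i m0 kT dL.
have H3 := sum_inv_rate d (levels - d.+1); rewrite Le in H1 H3.
have H4 : \sum_(m <= t < m + k) D * \sum_(0 <= j < d.+1) movement t j <=
    k%:R * (16 * D * rate d).
  have -> : k%:R * (16 * D * rate d) = \sum_(m <= t < m + k) 16 * D * rate d.
    by rewrite sumr_const_nat addnC addnK mulr_natl.
  by apply: ler_sum => t _; exact: sum_movement_le.
have e0 := rate_gt0 d.
have H5 : 1 <= 1 / rate d.
  rewrite ler_pdivlMr// mul1r; apply: le_trans (rate_le4 dL) _.
  by rewrite ler_pdivrMr//; lra.
have -> : \sum_(m <= t < m + k) total_cost t =
    \sum_(m <= t < m + k)
      (cost t levels + D * \sum_(d.+1 <= j < levels) movement t j)
    + \sum_(m <= t < m + k) D * \sum_(0 <= j < d.+1) movement t j.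
  rewrite -big_split /=; apply: eq_bigr => t _.
  by rewrite /total_cost (big_cat_nat (n := d.+1))//=; ring.
have : k%:R * (16 * D * rate d) <= 16 * (D + 1) * rate d * k%:R.
  rewrite mulrC ler_wpM2r// ler_wpM2r ?ltW//.
  by have D0 := D_ge0; lra.
by lra.
Qed.

(** A loss is at most 1, and since the finest rate is at most [1 / (4 (D + 1))], all movements
    together cost at most 4 per step. *)
Lemma trivial_regret m k : \sum_(m <= t < m + k) total_cost t <= 5 * k%:R.
Proof.
have -> : 5 * k%:R = \sum_(m <= t < m + k) 5 :> R.
  by rewrite sumr_const_nat addnC addnK mulr_natr.
apply: ler_sum => t _; rewrite /total_cost.
have /andP[_ c1] : 0 <= cost t levels <= 1.
  by apply: avg01 => //; exact: distr_weights.
have L1 : (levels.-1 < levels)%N by [].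
have := sum_movement_le t L1; have := rate_le L1.
rewrite ler_pdivlMr ?mulr_gt0//= => r1.
have Dr : 0 <= rate levels.-1 by rewrite ltW// rate_gt0.
have D0 := D_ge0.
by lra.
Qed.

(** * The level suited to an interval *)

Lemma power_bracket (x : R) n : 1 <= x -> x < 4 ^+ n ->
  exists2 s, (s < n)%N & 4 ^+ s <= x < 4 ^+ s.+1.
Proof.
move=> x1; elim: n => [|n IH xn]; first by rewrite expr0 ltNge x1.
have [/IH[s sn sx]|nx] := ltP x (4 ^+ n); first by exists s => //; lia.
by exists n => //; rewrite nx.
Qed.

Lemma ln2_ge : 1 / 2 <= ln 2 :> R.
Proof.
have : ln (1 + - (1 / 2)) <= - (1 / 2) :> R by apply: le_ln1Dx; lra.
have -> : 1 + - (1 / 2) = 2^-1 :> R by field.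
by rewrite lnV ?posrE//; lra.
Qed.

(** The ideal rate is of order [sqrt (Lam / ((D + 1) k))]. Rates being powers of 2 apart, a level
    with rate [1 / (4 (D + 1) M)] and [M^2 <= k / Y < 4 M^2] is within a constant factor of it. The
    two terms of [regret_scale] become at most [64 W] and [12 W]. *)
Lemma regret_bound m k (i : 'I_N) : (0 < m)%N -> (k <= T)%N -> (1 < N * T)%N ->
  \sum_(m <= t < m + k) total_cost t <=
  \sum_(m <= t < m + k) ell t i
  + 100 * Num.sqrt ((D + 1) * k%:R * ln (N * T)%:R).
Proof.
move=> m0 kT NT1.
set Lam := ln (N * T)%:R; set W := Num.sqrt _.
have ln2 := ln2_ge.
have n2 : 2 <= (N * T)%:R :> R by rewrite ler_nat.
have n0 : 0 < (N * T)%:R :> R by lra.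
have Lam2 : ln 2 <= Lam by rewrite /Lam ler_ln ?posrE.
have Lam0 : 0 < Lam by lra.
pose Y := (D + 1) * Lam.
have D0 := D_ge0; have D1 := D1_gt0.
have Y0 : 0 < Y by rewrite mulr_gt0.
have W0 : 0 <= W by rewrite sqrtr_ge0.
have k0 : 0 <= k%:R :> R by [].
have W2 : W ^+ 2 = Y * k%:R.
  by rewrite sqr_sqrtr 1?mulrAC// !mulr_ge0// ltW.
(* For [k < Y] the trivial bound suffices, as then [k <= sqrt (Y k) = W]. *)
have [kY|Yk] := ltP (k%:R : R) Y.
  apply: le_trans (trivial_regret m k) _.
  have : 0 <= \sum_(m <= t < m + k) ell t i.
    by apply: sumr_ge0 => t _; have /andP[] := ell01 t i.
  have : k%:R <= W.
    by rewrite -ler_sqr ?nnegrE// W2 expr2 ler_wpM2r// ltW.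
  by lra.
have kTR : k%:R <= T%:R :> R by rewrite ler_nat.
have T1 : 1 <= T%:R :> R by rewrite ler1n.
have kLam : k%:R / Lam <= 2 * T%:R.
  rewrite ler_pdivrMr//.
  have : T%:R * (1 / 2) <= T%:R * Lam by rewrite ler_wpM2l//; lra.
  by lra.
have x1 : 1 <= k%:R / Y by rewrite ler_pdivlMr// mul1r.
have kY2 : k%:R / Y <= 2 * T%:R.
  apply: le_trans kLam; rewrite ler_wpM2l// lef_pV2 ?posrE// /Y.
  by rewrite ler_peMl ?(ltW Lam0)//; lra.
(* The levels reach far enough: [2 T < 4^levels], because [2^levels] exceeds [T] and is at least
   2. *)
have xL : k%:R / Y < 4 ^+ levels.
  apply: le_lt_trans kY2 _.
  rewrite -natrX -natrM ltr_nat -[4%N]/(2 ^ 2)%N -expnM [(2 * levels)%N]mulnC expnM.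
  have : (T < 2 ^ levels)%N by rewrite /levels trunc_log_ltn.
  have : (2 <= 2 ^ levels)%N by rewrite /levels expnS leq_pmulr// expn_gt0.
  move: (2 ^ levels)%N => h h2 Th; rewrite -mulnn.
  by apply: leq_trans (_ : 2 * h <= _)%N; rewrite ?ltn_pmul2l// leq_mul2r h2 orbT.
have [s sL /andP[sx xs]] := power_bracket x1 xL.
pose M : R := 2 ^+ s.
have M1 : 1 <= M by rewrite exprn_ege1// ler1n.
have M0 : 0 < M by lra.
have e4 : 4 ^+ s = M ^+ 2 :> R by rewrite -exprM mulnC exprM expr2 -natrM.
rewrite e4 in sx; rewrite exprS e4 in xs.
have dL : (levels - s.+1 < levels)%N by rewrite ltn_subrL.
apply: le_trans (regret_scale i m0 kT dL) _.
rewrite rate_level// -/M -addrA lerD2l.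
have DM0 : 0 < 4 * (D + 1) * M by rewrite !mulr_gt0//; lra.
rewrite !div1r !invrK.
have sx' : M ^+ 2 * Y <= k%:R by rewrite -ler_pdivlMr.
have xs' : k%:R <= 4 * M ^+ 2 * Y by rewrite -ler_pdivrMr// ltW.
have YM : Y * M <= W.
  have YM0 : 0 <= Y * M by apply: mulr_ge0; [exact: ltW | lra].
  rewrite -ler_sqr ?nnegrE// W2.
  have -> : (Y * M) ^+ 2 = Y * (M ^+ 2 * Y) by ring.
  by rewrite ler_wpM2l// ltW.
have kM : k%:R / M <= 2 * W.
  rewrite -ler_sqr ?nnegrE; last 2 first.
  - by rewrite divr_ge0// ltW.
  - by rewrite mulr_ge0.
  rewrite !exprMn W2 exprVn ler_pdivrMr ?exprn_gt0//.
  have -> : 2 ^+ 2 * (Y * k%:R) * M ^+ 2 = (4 * M ^+ 2 * Y) * k%:R by ring.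
  by rewrite expr2 ler_wpM2r.
(* No logarithm of [D] survives: the choice of [M] forces [(D + 1) M <= k / Lam <= 2 N T], so the
   argument is at most [16 (N T)^2]. *)
have lnB : ln (2 * (N * T)%:R * (4 * (D + 1) * M)) <= 6 * Lam.
  have DM : (D + 1) * M <= 2 * (N * T)%:R.
    apply: le_trans (_ : k%:R / Lam <= _).
      rewrite ler_pdivlMr//; apply: le_trans sx'.
      have -> : M ^+ 2 * Y = (D + 1) * M * Lam * M by rewrite /Y; ring.
      have h0 : 0 < (D + 1) * M * Lam by rewrite !mulr_gt0//; lra.
      by apply: ler_peMr => //; exact: ltW.
    apply: le_trans kLam _; rewrite ler_wpM2l// ler_nat leq_pmull//.
  have -> : 6 * Lam = 4 * Lam + (Lam + Lam) by ring.
  apply: le_trans (_ : 4 * ln 2 + (Lam + Lam) <= _); last by lra.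
  have -> : 4 * ln 2 = ln (2 ^+ 4) :> R by rewrite lnXn// mulr_natl.
  rewrite /Lam -!lnM ?posrE ?mulr_gt0 ?exprn_gt0//.
  rewrite ler_ln ?posrE ?mulr_gt0 ?exprn_gt0//.
  move: ((N * T)%:R : R) n0 DM => z z0 DM.
  have : z * ((D + 1) * M) <= z * (2 * z) by rewrite ler_wpM2l// ltW.
  by lra.
(* Here [5 <= 10 Lam], because [Lam >= ln 2 >= 1/2]. *)
have A1 : (ln (2 * (N * T)%:R * (4 * (D + 1) * M)) + 5) * (4 * (D + 1) * M)
    <= 64 * (Y * M).
  have -> : 64 * (Y * M) = 16 * Lam * (4 * (D + 1) * M) by rewrite /Y; ring.
  by rewrite ler_wpM2r ?(ltW DM0)//; lra.
have -> : 24 * (D + 1) * (4 * (D + 1) * M)^-1 * k%:R = 6 * (k%:R / M).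
  by field; rewrite !gt_eqF//; lra.
by lra.
Qed.

End AllLevels.

(** * Coupling of consecutive distributions *)

Section Transition.
Variables (R : realType) (N : nat) (P Q : nat -> R).

Definition excess (i : nat) : R := if Q i <= P i then 0 else Q i - P i.

Definition cumul (n : nat) : R := \sum_(i < n) excess i.

Definition crossed (x : nat) (u : R) (i : nat) : bool :=
  (u * P x - Q x) * cumul N <= (P x - Q x) * cumul i.+1.

(** The first crossed index, capped at [n]. It is obtained as the successor of the last index not
    crossed, which a loop finds by overwriting. *)
Fixpoint pick_expert (x : nat) (u : R) (n : nat) : nat :=
  if n is n'.+1 then if crossed x u n' then pick_expert x u n' else n'.+1 else 0%N.

(* One uniform [u] serves both choices: given that [x] is not kept,
   [u * P x - Q x] is uniform between 0 and [P x - Q x], and it selects the new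
   expert with probability proportional to [excess]. *)
Definition next_expert (x : nat) (u : R) : nat :=
  if u * P x <= Q x then x else pick_expert x u N.-1.

Lemma pick_le x u n : (pick_expert x u n <= n)%N.
Proof. by elim: n => //= n IH; case: ifP => // _; exact: leqW. Qed.

Lemma next_lt x u : (x < N)%N -> (next_expert x u < N)%N.
Proof.
rewrite /next_expert => xN; case: ifP => // _.
by have := pick_le x u N.-1; lia.
Qed.

Lemma excess_ge0 i : 0 <= excess i.
Proof. by rewrite /excess; case: (leP (Q i)) => // h; rewrite subr_ge0 ltW. Qed.

Lemma cumulS n : cumul n.+1 = cumul n + excess n.
Proof. by rewrite /cumul big_ord_recr. Qed.

Lemma cumul_le m n : (m <= n)%N -> cumul m <= cumul n.
Proof.
move=> /subnKC <-; elim: (n - m)%N => [|k IH]; first by rewrite addn0.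
rewrite addnS; apply: le_trans IH _.
by rewrite cumulS lerDl excess_ge0.
Qed.

Lemma cumul_ge0 n : 0 <= cumul n.
Proof. by apply: sumr_ge0 => i _; exact: excess_ge0. Qed.

(** [crossed x u] is monotone in the index, as [cumul] is, so the pick is settled by the two tests
    next to it. *)
Lemma pick_eq x u n m : Q x <= P x -> (m <= n)%N ->
  (pick_expert x u n == m) =
  ((m == 0%N) || ~~ crossed x u m.-1) && ((m == n) || crossed x u m).
Proof.
move=> QP; have mono i j : (i <= j)%N -> crossed x u i -> crossed x u j.
  move=> ij; rewrite /crossed => /le_trans; apply.
  by rewrite ler_wpM2l ?subr_ge0// cumul_le.
elim: n m => [|n IH] m.
  by rewrite leqn0 => /eqP -> /=.
rewrite leq_eqVlt => /orP[/eqP ->|mn] /=.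
  rewrite eqxx andbT; case: ifP => /= h; last by rewrite eqxx.
  by have := pick_le x u n; case: eqP => //; lia.
case: ifP => h; last first.
  have -> : (n.+1 == m) = false by lia.
  have -> : (m == n.+1) = false by lia.
  rewrite /=; case c : (crossed x u m); last by rewrite andbF.
  by rewrite (mono m n) in h.
rewrite IH//.
have -> : (m == n.+1) = false by lia.
by case: (m =P n) => [->|_] //=; rewrite h.
Qed.

Hypotheses (Pd : distr N P) (Qd : distr N Q).

(** * Law of one transition *)

Lemma uniform_prob_sub (B : set R) (a b : R) : measurable B ->
  0 <= a -> a <= b -> b <= 1 ->
  (forall u, 0 <= u <= 1 -> B u <-> a < u <= b) ->
  uniform_prob (@ltr01 R) B = (b - a)%:E.
Proof.
move=> mB a0 ab b1 BE; rewrite /uniform_prob integral_uniform_pdf.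
transitivity (\int[lebesgue_measure]_(x in B `&` `[0%R, 1%R]) cst 1%E x)%E.
  apply: eq_integral => u; rewrite inE => -[_] /=; rewrite in_itv/= => u01.
  by rewrite /uniform_pdf u01 subr0 invr1.
rewrite integral_cst; last exact: measurableI.
rewrite mul1e; have -> : B `&` `[0, 1]%classic = `]a, b]%classic.
  apply/seteqP; split=> u /=; rewrite !in_itv/=.
    by move=> [/BE H u01]; apply: H.
  move=> /andP[au ub]; have u01 : 0 <= u <= 1.
    by rewrite (le_trans a0 (ltW au)) (le_trans ub b1).
  by split => //; apply/BE => //; rewrite au.
rewrite /= lebesgue_measure_itv /= lte_fin.
by case: ltP => // ba; rewrite (_ : a = b) ?subrr//; apply/eqP; rewrite eq_le ab.
Qed.

Lemma uniform_prob_sub0 (B : set R) (b : R) : measurable B ->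
  0 <= b -> b <= 1 ->
  (forall u, 0 <= u <= 1 -> B u <-> u <= b) ->
  uniform_prob (@ltr01 R) B = b%:E.
Proof.
move=> mB b0 b1 BE; rewrite /uniform_prob integral_uniform_pdf.
transitivity (\int[lebesgue_measure]_(x in B `&` `[0%R, 1%R]) cst 1%E x)%E.
  apply: eq_integral => u; rewrite inE => -[_] /=; rewrite in_itv/= => u01.
  by rewrite /uniform_pdf u01 subr0 invr1.
rewrite integral_cst; last exact: measurableI.
rewrite mul1e; have -> : B `&` `[0, 1]%classic = `[0, b]%classic.
  apply/seteqP; split=> u /=; rewrite !in_itv/=.
    by move=> [/BE H /andP[u0 u1]]; rewrite u0; apply: H; rewrite u0.
  move=> /andP[u0 ub]; have u01 : 0 <= u <= 1 by rewrite u0 (le_trans ub b1).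
  by split => //; apply/BE.
rewrite /= lebesgue_measure_itv /= lte_fin.
by case: ltP => [_|ba]; rewrite ?sube0// (_ : b = 0)//; apply/eqP; rewrite eq_le ba.
Qed.

Lemma measurable_crossed x i : measurable_fun [set: R] (fun u => crossed x u i).
Proof.
apply: measurable_fun_ler => //.
by apply: measurable_funM => //; apply: measurable_funB => //; exact: measurable_funM.
Qed.

Lemma measurable_pick x n : measurable_fun [set: R] (fun u => pick_expert x u n).
Proof.
elim: n => [|n IH] //=; apply: measurable_fun_ifT => //.
exact: measurable_crossed.
Qed.

Lemma measurable_next x : measurable_fun [set: R] (next_expert x).
Proof.
apply: measurable_fun_ifT => //; last exact: measurable_pick.
by apply: measurable_fun_ler => //; exact: measurable_funM.
Qed.

Lemma measurable_next_eq x i : measurable [set u | next_expert x u = i].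
Proof.
have mi : measurable [set i] by [].
by have := measurable_next x measurableT mi; rewrite setTI.
Qed.

(** Both distributions have mass 1, so what some experts gain is what others lose. *)
Lemma cumul_total : cumul N = \sum_(i < N) (P i - Num.min (P i) (Q i)).
Proof.
have e i : excess i = Q i - Num.min (P i) (Q i).
  rewrite /excess /Order.min; by case: (leP (Q i)); rewrite ?subrr.
rewrite /cumul; under eq_bigr do rewrite e.
rewrite !sumrB; congr (_ - _).
by have [_ P1] := Pd; have [_ Q1] := Qd; rewrite -/(mass N Q) -/(mass N P) P1.
Qed.

Lemma cumul_total_gt0 x : (x < N)%N -> Q x < P x -> 0 < cumul N.
Proof.
move=> xN QP; rewrite cumul_total (bigD1 (Ordinal xN))//= ltr_wpDr//.
  by apply: sumr_ge0 => i _; rewrite subr_ge0 ge_min lexx.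
by rewrite subr_gt0 gt_min QP orbT.
Qed.

(** From [x] with [Q x < P x], coins up to [threshold x 0] keep [x], and those between
    [threshold x i] and [threshold x i.+1] lead to [i]. *)
Definition threshold x n : R :=
  (Q x + (P x - Q x) * (cumul n / cumul N)) / P x.

Lemma threshold_le x m n : Q x < P x -> (m <= n)%N ->
  threshold x m <= threshold x n.
Proof.
move=> QP mn; have [Q0 _] := Qd; have Px : 0 < P x by exact: le_lt_trans QP.
rewrite /threshold ler_pM2r ?invr_gt0// lerD2l ler_pM2l ?subr_gt0//.
by rewrite ler_wpM2r ?cumul_le// invr_ge0 cumul_ge0.
Qed.

Lemma threshold0 x : threshold x 0 = Q x / P x.
Proof. by rewrite /threshold /cumul big_ord0 mul0r mulr0 addr0. Qed.

Lemma thresholdN x : (x < N)%N -> Q x < P x -> threshold x N = 1.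
Proof.
move=> xN QP; have [Q0 _] := Qd; have Px : 0 < P x by exact: le_lt_trans QP.
rewrite /threshold divff ?gt_eqF ?(cumul_total_gt0 xN QP)//.
by rewrite mulr1 addrC subrK divff// gt_eqF.
Qed.

Lemma crossedE x u n : (x < N)%N -> Q x < P x ->
  crossed x u n = (u <= threshold x n.+1).
Proof.
move=> xN QP; have [Q0 _] := Qd; have Px : 0 < P x by exact: le_lt_trans QP.
have E0 := cumul_total_gt0 xN QP.
rewrite /crossed /threshold [RHS]ler_pdivlMr// -[LHS]ler_pdivlMr//.
by rewrite lerBlDl mulrA.
Qed.

Lemma keepE x u : Q x < P x -> (u * P x <= Q x) = (u <= threshold x 0).
Proof.
move=> QP; have [Q0 _] := Qd; have Px : 0 < P x by exact: le_lt_trans QP.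
by rewrite threshold0 ler_pdivlMr.
Qed.

Lemma pick_threshold x u m : (x < N)%N -> Q x < P x -> (m < N)%N -> u <= 1 ->
  threshold x 0 < u ->
  (pick_expert x u N.-1 == m) = (threshold x m < u <= threshold x m.+1).
Proof.
move=> xN QP mN u1 u0; rewrite pick_eq; [|exact: ltW|lia].
rewrite !crossedE//; congr andb.
  by case: m mN => [|m] mN /=; rewrite ?u0// ltNge.
case: eqP => //= mN1; apply/esym.
by rewrite (_ : m.+1 = N) ?thresholdN//; lia.
Qed.

(** The joint law of the maximal coupling: the minimum on the diagonal, and elsewhere the mass lost
    at [x] spread in proportion to the excess. Multiplying by [P x] avoids conditioning on an event
    that may have probability 0. *)
Lemma next_law x i : (x < N)%N -> (i < N)%N ->
  ((P x)%:E * uniform_prob (@ltr01 R) [set u | next_expert x u = i] =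
   ((x == i)%:R * Num.min (P x) (Q x)
    + (P x - Num.min (P x) (Q x)) * (excess i / cumul N))%:E)%E.
Proof.
move=> xN iN; have [P0 _] := Pd; have [Q0 _] := Qd.
have mB := measurable_next_eq x i.
have [PQ|QP] := leP (P x) (Q x).
  rewrite subrr mul0r addr0.
  have keep u : 0 <= u <= 1 -> next_expert x u = x.
    move=> /andP[u0 u1]; rewrite /next_expert ifT//; apply: le_trans PQ.
    by rewrite ler_piMl.
  case: eqP => xi.
    rewrite (uniform_prob_sub0 (b := 1) mB)// ?mule1 ?mul1r// => u u01.
    by rewrite /= keep// xi; have /andP[_ ->] := u01.
  rewrite (uniform_prob_sub (a := 0) (b := 0) mB)//.
    by rewrite subrr mule0 mul0r.
  move=> u u01; rewrite /= keep//; split=> // /andP[u0].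
  by rewrite leNgt u0.
have Px : 0 < P x by exact: le_lt_trans QP.
have E0 := cumul_total_gt0 xN QP.
have t0 : 0 <= threshold x 0 by rewrite threshold0 divr_ge0// ltW.
have tN n : (n <= N)%N -> threshold x n <= 1.
  by move=> nN; rewrite -(thresholdN xN QP) threshold_le.
have t0n n : threshold x 0 <= threshold x n by exact: threshold_le.
have nextE u : 0 <= u <= 1 ->
    next_expert x u = if u <= threshold x 0 then x else pick_expert x u N.-1.
  by move=> _; rewrite /next_expert keepE.
case: eqP => [xi|/eqP xi].
  (* The interval of coins that would pick [x] again is empty, so [x] is kept only by the first
     test. *)
  have ex0 : excess i = 0 by rewrite -xi /excess ltW.
  rewrite (uniform_prob_sub0 (b := threshold x 0) mB)//; last 2 first.
  - exact: tN.
  - move=> u /= u01; rewrite nextE//.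
    case: (leP u (threshold x 0)) => [|u0]; first by rewrite xi.
    have /andP[_ u1] := u01; split=> // /eqP.
    rewrite pick_threshold// => /andP[h1 h2].
    move: (lt_le_trans h1 h2); rewrite /threshold cumulS ex0.
    by rewrite addr0 ltxx.
  rewrite ex0 mul0r mulr0 addr0 mul1r -EFinM.
  by rewrite threshold0 mulrC divfK// gt_eqF.
rewrite (uniform_prob_sub (a := threshold x i) (b := threshold x i.+1) mB)//.
- rewrite mul0r add0r -EFinM; congr EFin.
  rewrite /threshold cumulS.
  by field; rewrite !gt_eqF.
- exact: le_trans (t0n i).
- exact: threshold_le.
- exact: tN.
move=> u /= u01; rewrite nextE//; case: (leP u (threshold x 0)) => u0; last first.
  have /andP[_ u1] := u01.
  by have := pick_threshold xN QP iN u1 u0 => <-; split=> /eqP.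
split=> [xi'|/andP[h _]]; first by rewrite xi' eqxx in xi.
by have := le_lt_trans (le_trans u0 (t0n i)) h; rewrite ltxx.
Qed.

Lemma next_marginal i : (i < N)%N ->
  \sum_(x < N) (((x : nat) == i)%:R * Num.min (P x) (Q x)
    + (P x - Num.min (P x) (Q x)) * (excess i / cumul N)) = Q i.
Proof.
move=> iN; rewrite big_split /= -mulr_suml -cumul_total.
rewrite (bigD1 (Ordinal iN))//= eqxx mul1r big1 ?addr0; last first.
  by move=> j; rewrite -val_eqE /= => /negbTE ->; rewrite mul0r.
(* If the total excess is 0, the quotient is 0 by convention and every [Q i <= P i]. *)
have [E0|E0] := eqVneq (cumul N) 0.
  have : excess i <= cumul N.
    rewrite /cumul (bigD1 (Ordinal iN))//= lerDl.
    by apply: sumr_ge0 => j _; exact: excess_ge0.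
  rewrite E0 mul0r addr0 /excess; case: (leP (Q i)) => QP h //.
  by move: QP; rewrite -subr_gt0 ltNge h.
rewrite mulrC divfK// /excess; case: (leP (Q i)) => QP; first by rewrite addr0.
by rewrite subrKC.
Qed.

Lemma next_switch x : (x < N)%N ->
  ((P x)%:E * uniform_prob (@ltr01 R) [set u | next_expert x u <> x] <=
   (P x - Num.min (P x) (Q x))%:E)%E.
Proof.
move=> xN.
have -> : uniform_prob (@ltr01 R) [set u | next_expert x u <> x] =
    (1 - uniform_prob (@ltr01 R) [set u | next_expert x u = x])%E.
  exact: (probability_setC (uniform_prob (@ltr01 R)) (measurable_next_eq x x)).
have [P0 _] := Pd; have [Q0 _] := Qd.
have := next_law xN xN; rewrite eqxx mul1r.
set U := uniform_prob _ _ => H.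
have : U \is a fin_num by apply: fin_num_measure; exact: measurable_next_eq.
case: U H => // r H _; rewrite -[1%E]/(1%:E) -EFinB -EFinM lee_fin.
move: H => [H]; rewrite mulrBr mulr1 H.
rewrite opprD addrA lerBlDr lerDl mulr_ge0 ?divr_ge0 ?excess_ge0 ?cumul_ge0//.
by rewrite subr_ge0 ge_min lexx.
Qed.

Lemma sum_loss_min : \sum_(x < N) (P x - Num.min (P x) (Q x)) = l1dist N Q P / 2.
Proof.
have e : l1dist N Q P = \sum_(x < N) (P x - Num.min (P x) (Q x))
    + \sum_(x < N) (Q x - Num.min (P x) (Q x)).
  rewrite -big_split; apply: eq_bigr => x _ /=.
  by have [h|h] := leP (P x) (Q x); [rewrite ger0_norm|rewrite ltr0_norm];
    rewrite ?subr_ge0 ?subr_lt0//; ring.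
rewrite e !sumrB; have [_ P1] := Pd; have [_ Q1] := Qd.
rewrite -/(mass N Q) -/(mass N P) P1 Q1.
by field.
Qed.

End Transition.

(** * The sequence of experts *)

(** Coin [t] drives the move from time [t] to [t + 1]. The start at expert 0 agrees with the law
    [pi 0] assumed below. *)
Fixpoint walk (R : realType) (N : nat) (pi : nat -> nat -> R) (u : nat -> R)
    (t : nat) : nat :=
  if t is t'.+1 then next_expert N (pi t') (pi t'.+1) (walk N pi u t') (u t') else 0%N.

Section Walk.
Variables (R : realType) (N : nat) (pi : nat -> nat -> R).
Variables (d : measure_display) (W : measurableType d) (Pr : probability W R).
Variable U : nat -> {RV Pr >-> R}.
Hypothesis N_gt0 : (0 < N)%N.
Hypothesis pi_distr : forall t, distr N (pi t).
Hypothesis pi0 : forall i, pi 0 i = (i == 0%N)%:R.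
Hypothesis U_iid : iid_uniform01 U.

Let X t w := walk N pi (fun j => U j w) t.
Let unif := uniform_prob (@ltr01 R).
Let box m (B : nat -> set R) := \bigcap_(j in `I_m) (U j @^-1` B j).

Lemma walk_lt u t : (walk N pi u t < N)%N.
Proof. by elim: t => //= t IH; exact: next_lt. Qed.

(** Splitting by the current expert reduces an event on the position and the next coin to finitely
    many rectangles. *)
Lemma walk_decomp n (C : nat -> set R) :
  [set w | C (X n w) (U n w)] =
  \big[setU/set0]_(x < N) ([set w | X n w = x] `&` U n @^-1` C x).
Proof.
rewrite -(bigcup_mkord N (fun x => [set w | X n w = x] `&` U n @^-1` C x)).
apply/seteqP; split=> w /= => [Cw|[x _ /= [<-]]//].
by exists (X n w) => //=; exact: walk_lt.
Qed.

Lemma measurable_preU n (C : set R) : measurable C -> measurable (U n @^-1` C).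
Proof. by move=> mC; rewrite -[_ @^-1` _]setTI; exact: measurable_funP. Qed.

Lemma measurable_walk n i : measurable [set w | X n w = i].
Proof.
elim: n i => [|n IH] i.
  have [->|i0] := eqVneq i 0%N.
    by rewrite (_ : [set _ | _] = setT)//; apply/seteqP; split.
  rewrite (_ : [set _ | _] = set0)//; apply/seteqP; split=> // w /= /esym/eqP.
  by rewrite (negbTE i0).
rewrite (walk_decomp n (fun x => [set u | next_expert N (pi n) (pi n.+1) x u = i])).
apply: bigsetU_measurable => x _; apply: measurableI; first exact: IH.
by apply: measurable_preU; exact: measurable_next_eq.
Qed.

Lemma measurable_box m B : (forall j, measurable (B j)) -> measurable (box m B).
Proof.
move=> mB; apply: fin_bigcap_measurable => // j _.
exact: measurable_preU.
Qed.

Lemma prob_decomp n (C : nat -> set R) (A : set W) :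
  (forall x, measurable (C x)) -> measurable A ->
  Pr ([set w | C (X n w) (U n w)] `&` A) =
  (\sum_(x < N) Pr ([set w | X n w = x] `&` U n @^-1` C x `&` A))%E.
Proof.
move=> mC mA; rewrite walk_decomp big_distrl /=.
apply: (measure_bigsetU Pr
  (F := fun x => [set w | X n w = x] `&` U n @^-1` C x `&` A)).
  move=> x; apply: measurableI => //; apply: measurableI.
    exact: measurable_walk.
  exact: measurable_preU.
by move=> x y _ _ [w /= [[[-> _] _] [[-> _] _]]].
Qed.

(** States the marginal together with independence from the coins not yet used: [B] constrains only
    coins from [n] on. The marginal alone would not pass through the induction. *)
Lemma walk_law n m (B : nat -> set R) i : (n <= m)%N -> (i < N)%N ->
  (forall j, measurable (B j)) -> (forall j, (j < n)%N -> B j = setT) ->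
  Pr ([set w | X n w = i] `&` box m B) =
  ((pi n i)%:E * \prod_(j < m) unif (B j))%E.
Proof.
elim: n m B i => [|n IH] m B i nm iN mB BT.
  rewrite pi0; have [->|i0] := eqVneq i 0%N.
    by rewrite (_ : [set _ | _] = setT) ?setTI ?mul1e ?U_iid//; apply/seteqP; split.
  rewrite mul0e (_ : [set _ | _] = set0) ?set0I ?measure0//.
  apply/seteqP; split=> // w /= /esym/eqP.
  by rewrite (negbTE i0).
pose K x := [set u | next_expert N (pi n) (pi n.+1) x u = i].
have mK x : measurable (K x) by exact: measurable_next_eq.
rewrite (prob_decomp n mK (measurable_box m mB)).
(* Given position [x] at time [n], reaching [i] is a condition on coin [n], which [B] leaves free;
   it can thus be added to the box. *)
pose B' x j := if j == n then K x else B j.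
have mB' x j : measurable (B' x j) by rewrite /B'; case: ifP.
transitivity (\sum_(x < N) ((pi n x)%:E * unif (K x))
    * \prod_(j < m) unif (B j))%E.
  apply: eq_bigr => x _.
  have -> : [set w | X n w = x] `&` U n @^-1` K x `&` box m B =
      [set w | X n w = x] `&` box m (B' x).
    rewrite -setIA; congr (_ `&` _); apply/seteqP; split=> w.
      by move=> [Kw Bw] j jm; rewrite /B' /=; case: eqP => [->|_]//; exact: Bw.
    move=> Bw; split; first by have := Bw n nm; rewrite /B' /= eqxx.
    move=> j jm; have := Bw j jm; rewrite /B' /=; case: eqP => // -> _.
    by rewrite BT.
  rewrite IH//; [|exact: ltnW|]; last first.
    by move=> j jn; rewrite /B' (ltn_eqF jn) BT// leqW.
  rewrite -muleA; congr (_ * _)%E.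
  rewrite (bigD1 (Ordinal nm))//= [in RHS](bigD1 (Ordinal nm))//=.
  rewrite /B' eqxx (BT n)// [unif setT]probability_setT mul1e.
  congr (_ * _)%E; apply: eq_bigr => j; rewrite -val_eqE /= => /negbTE ->.
  by [].
rewrite -ge0_sume_distrl; last first.
  move=> x _; have [p0 _] := pi_distr n.
  by apply: mule_ge0; rewrite ?lee_fin//; exact: measure_ge0.
congr (_ * _)%E.
rewrite -(next_marginal (pi_distr n) (pi_distr n.+1) iN) -sumEFin.
by apply: eq_bigr => x _; rewrite next_law.
Qed.

Lemma walk_joint n x (C : set R) : (x < N)%N -> measurable C ->
  Pr ([set w | X n w = x] `&` U n @^-1` C) = ((pi n x)%:E * unif C)%E.
Proof.
move=> xN mC; pose B j := if j == n then C else setT.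
have mB j : measurable (B j) by rewrite /B; case: ifP.
have := @walk_law n n.+1 B x (leqnSn n) xN mB.
have -> : box n.+1 B = U n @^-1` C.
  apply/seteqP; split=> w.
    by move=> /(_ n (ltnSn n)); rewrite /B /= eqxx.
  by move=> Cw j jn; rewrite /B /=; case: eqP => // ->.
move=> ->; last by move=> j jn; rewrite /B (ltn_eqF jn).
rewrite (bigD1 ord_max)//= /B eqxx big1 ?mule1// => j.
rewrite -val_eqE /= => /negbTE ->.
by rewrite [unif setT]probability_setT.
Qed.

Lemma walk_marginal n i : (i < N)%N -> Pr [set w | X n w = i] = (pi n i)%:E.
Proof.
move=> iN; have := @walk_joint n i setT iN measurableT.
by rewrite preimage_setT setIT => ->; rewrite [unif setT]probability_setT mule1.
Qed.

Lemma switch_decomp n : [set w | X n.+1 w <> X n w] =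
  [set w | [set u | next_expert N (pi n) (pi n.+1) (X n w) u <> X n w] (U n w)].
Proof. by []. Qed.

Let mswitch n x : measurable [set u | next_expert N (pi n) (pi n.+1) x u <> x].
Proof.
rewrite (_ : [set u | _] = ~` [set u | next_expert N (pi n) (pi n.+1) x u = x])//.
by apply: measurableC; exact: measurable_next_eq.
Qed.

Lemma measurable_switch n : measurable [set w | X n.+1 w <> X n w].
Proof.
rewrite switch_decomp
  (walk_decomp n (fun x => [set u | next_expert N (pi n) (pi n.+1) x u <> x])).
apply: bigsetU_measurable => x _; apply: measurableI; first exact: measurable_walk.
exact: measurable_preU.
Qed.

Lemma walk_switch n :
  (Pr [set w | X n.+1 w <> X n w] <= (l1dist N (pi n.+1) (pi n) / 2)%:E)%E.
Proof.
rewrite switch_decomp -[X in Pr X]setIT.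
rewrite (prob_decomp n (C := fun x => [set u | next_expert N (pi n) (pi n.+1) x u <> x]))//.
rewrite -(sum_loss_min (pi_distr n) (pi_distr n.+1)) -sumEFin.
apply: lee_sum => x _; rewrite setIT walk_joint//.
exact: next_switch.
Qed.

Lemma expected_cost_le (D : R) (l : nat -> 'I_N -> R) (x : W -> nat -> 'I_N)
    t0 k : 0 <= D -> (forall t i, 0 <= l t i) ->
  (forall w t, val (x w t) = X t w) ->
  ('E_Pr[fun w => interval_cost D l (x w) t0 k] <=
   (\sum_(t0 + 1 <= t < t0 + k + 1) \sum_(i < N) l t i * pi t i
    + D * \sum_(t0 + 2 <= t < t0 + k + 1)
        (l1dist N (pi t) (pi t.-1) / 2))%:E)%E.
Proof.
move=> D0 l0 xE.
pose A t (i : 'I_N) := [set w | X t w = i].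
pose S t := [set w | X t w <> X t.-1 w].
have mA t i : measurable (A t i) by exact: measurable_walk.
have mS t : measurable (S t).
  case: t => [|t]; last exact: measurable_switch.
  by rewrite (_ : S 0%N = set0)//; apply/seteqP; split=> // w /=.
(* As a finite combination of indicators the cost is measurable, and its expectation reduces to
   marginals and switch probabilities. *)
have -> : (fun w => interval_cost D l (x w) t0 k) = (fun w =>
    \sum_(t0 + 1 <= t < t0 + k + 1) \sum_(i < N) l t i * \1_(A t i) w
    + \sum_(t0 + 2 <= t < t0 + k + 1) D * \1_(S t) w).
  apply/funext => w; rewrite /interval_cost mulr_sumr; congr (_ + _).
    apply: eq_bigr => t _; rewrite (bigD1 (x w t))//= big1.
      by rewrite indicE mem_set /A /= ?xE// mulr1 addr0.
    move=> i ix; rewrite indicE memNset ?mulr0// /A /= -xE => e.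
    by move/eqP: ix; apply; apply: val_inj.
  apply: eq_bigr => t _; congr (_ * _); rewrite indicE; congr (_%:R).
  have -> : (x w t != x w t.-1) = (X t w != X t.-1 w) by rewrite -val_eqE !xE.
  by congr nat_of_bool; apply/idP/idP => [/eqP h|]; [rewrite mem_set|
    rewrite inE => /eqP].
rewrite unlock.
have ge1 t (i : 'I_N) w : (0 <= (l t i * \1_(A t i) w)%:E)%E.
  by rewrite lee_fin mulr_ge0.
have m1 t (i : 'I_N) : measurable_fun setT (fun w => (l t i * \1_(A t i) w)%:E).
  by apply/measurable_EFinP; apply: measurable_funM => //; exact: measurable_indic.
have ge2 t w : (0 <= (D * \1_(S t) w)%:E)%E by rewrite lee_fin mulr_ge0.
have m2 t : measurable_fun setT (fun w => (D * \1_(S t) w)%:E).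
  by apply/measurable_EFinP; apply: measurable_funM => //; exact: measurable_indic.
have m3 t : measurable_fun setT (fun w => \sum_(i < N) (l t i * \1_(A t i) w)%:E)%E.
  exact: emeasurable_sum.
under eq_integral => w _.
  rewrite /= EFinD -!sumEFin.
  under eq_bigr => t _ do rewrite -sumEFin.
  over.
rewrite ge0_integralD//; last 4 first.
- by move=> w _; apply: sume_ge0 => t _; exact: sume_ge0.
- exact: emeasurable_sum.
- by move=> w _; apply: sume_ge0.
- exact: emeasurable_sum.
rewrite (ge0_integral_sum Pr measurableT m3); last first.
  by move=> t w _; exact: sume_ge0.
rewrite (ge0_integral_sum Pr measurableT m2)//.
rewrite EFinD mulr_sumr -!sumEFin; apply: leeD.
  apply: lee_sum => t _; rewrite (ge0_integral_sum Pr measurableT (m1 t))//.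
  rewrite -sumEFin; apply: lee_sum => i _.
  under eq_integral do rewrite EFinM.
  rewrite ge0_integralZl_EFin//; last first.
    by apply/measurable_EFinP; exact: measurable_indic.
  rewrite integral_indic// setIT EFinM; apply: lee_wpmul2l; first by rewrite lee_fin.
  by rewrite -(walk_marginal t (ltn_ord i)).
rewrite !big_nat; apply: lee_sum => t /andP[t2 _].
under eq_integral do rewrite EFinM.
rewrite ge0_integralZl_EFin//; last first.
  by apply/measurable_EFinP; exact: measurable_indic.
rewrite integral_indic// setIT EFinM lee_wpmul2l ?lee_fin//.
case: t t2 => [|t t2]; first by rewrite addn2.
exact: (walk_switch t).
Qed.

End Walk.

(** * The program *)

(* Memory layout. Natural numbers: 0 current expert, 1 a power of 2, 2 number of
   levels, 3 loop counter, 4 address of the weights of the current level.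
   Reals: 0 rate, 1 average loss, 2 mass of the old weights, 3 mass of the raw
   weights, 5 its truncation, 6-10 sampling; from 16 on, blocks of N cells: the
   mixture for the previous round, the one for the current round, and the
   weights of the levels. *)

Local Notation nv k := (NMem (NLit k)).
Local Notation rv k := (RMem (NLit k)).
Local Notation rlit k := (RNat (NLit k)).
Local Notation old_cell := (NAdd (NLit 16) (nv 3)).
Local Notation cur_cell := (NAdd (NAdd (NLit 16) NExperts) (nv 3)).
Local Notation weight_cell := (NAdd (nv 4) (nv 3)).

(** Always true: a [While] with this test is ended only by its iteration bound. *)
Definition forever_test : test := TNat (NLit 0) (NLit 0).

Definition for_loop (n : nexp) (c : cmd) : cmd :=
  Seq (NSet (NLit 3) (NLit 0))
      (While n forever_test (Seq c (NSet (NLit 3) (NAdd (nv 3) (NLit 1))))).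

Definition averaging_body : cmd :=
  Seq (RSet (NLit 1) (RAdd (rv 1) (RMul (RLoss (nv 3)) (RMem old_cell))))
      (RSet (NLit 2) (RAdd (rv 2) (RMem weight_cell))).

(** The mixture of the previous round belongs to the old weights, so it is formed before the weight
    is overwritten. *)
Definition growing_body : cmd :=
  Seq (RSet old_cell (RAdd (RMem weight_cell)
         (RMul (RSub (rlit 1) (rv 2)) (RMem old_cell))))
  (Seq (RSet weight_cell (RAdd (RMul (RMem weight_cell) (RAdd (rlit 1)
          (RMul (rv 0) (RSub (RSub (rv 1) (RLoss (nv 3)))
             (RMul (RMul (rlit 4) RSwitch) (rv 0))))))
          (RDiv (rv 0) (RNat (NMul NExperts NHorizon)))))
       (RSet (NLit 3) (RAdd (rv 3) (RMem weight_cell)))).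

Definition normalizing_body : cmd :=
  Seq (RSet weight_cell (RDiv (RMem weight_cell) (rv 5)))
      (RSet cur_cell (RAdd (RMem weight_cell)
         (RMul (RSub (rlit 1) (RDiv (rv 3) (rv 5))) (RMem cur_cell)))).

Definition level_pass : cmd :=
  Seq (Seq (RSet (NLit 1) (rlit 0))
        (Seq (RSet (NLit 2) (rlit 0)) (RSet (NLit 3) (rlit 0))))
  (Seq (for_loop NExperts averaging_body)
  (Seq (for_loop NExperts growing_body)
  (Seq (If (TReal (rv 3) (rlit 1)) (RSet (NLit 5) (rlit 1)) (RSet (NLit 5) (rv 3)))
       (for_loop NExperts normalizing_body)))).

Definition advance : cmd :=
  Seq (NSet (NLit 4) (NAdd (nv 4) NExperts)) (RSet (NLit 0) (RMul (rlit 2) (rv 0))).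

(** Doubles until the power of 2 exceeds [T]. This takes [levels T <= T] doublings, so the loop
    bound does not cut it short. *)
Definition count_levels : cmd :=
  Seq (Seq (NSet (NLit 1) (NLit 1)) (NSet (NLit 2) (NLit 0)))
      (While NHorizon (TNat (nv 1) NHorizon)
         (Seq (NSet (NLit 1) (NMul (NLit 2) (nv 1)))
              (NSet (NLit 2) (NAdd (nv 2) (NLit 1))))).

Definition clearing_body : cmd :=
  Seq (RSet old_cell (rlit 0)) (RSet cur_cell (rlit 0)).

(** Both mixtures are rebuilt in every round from the point mass at expert 0; what carries over is
    the weights and the current expert. *)
Definition setup : cmd :=
  Seq (for_loop NExperts clearing_body)
  (Seq (Seq (RSet (NLit 16) (rlit 1)) (RSet (NAdd (NLit 16) NExperts) (rlit 1)))
  (Seq (NSet (NLit 4) (NAdd (NAdd (NLit 16) NExperts) NExperts))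
       (RSet (NLit 0) (RDiv (rlit 1)
          (RMul (RMul (rlit 2) (RAdd RSwitch (rlit 1))) (RNat (nv 1))))))).

Definition add_excess (a : nat) : cmd :=
  If (TReal (RMem cur_cell) (RMem old_cell)) Skip
     (RSet (NLit a) (RAdd (rv a) (RSub (RMem cur_cell) (RMem old_cell)))).

Definition picking_body : cmd :=
  Seq (add_excess 10)
      (If (TReal (RMul (rv 7) (rv 9)) (RMul (rv 8) (rv 10)))
          Skip (NSet (NLit 0) (NAdd (nv 3) (NLit 1)))).

(** The first loop finds the total excess; the second accumulates it anew and tests each partial
    sum. The last expert needs no test, being the default. *)
Definition resample : cmd :=
  Seq (Seq (RSet (NLit 7) (RSub (RMul (rv 6) (RMem (NAdd (NLit 16) (nv 0))))
                         (RMem (NAdd (NAdd (NLit 16) NExperts) (nv 0)))))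
      (Seq (RSet (NLit 8) (RSub (RMem (NAdd (NLit 16) (nv 0)))
                           (RMem (NAdd (NAdd (NLit 16) NExperts) (nv 0)))))
      (Seq (RSet (NLit 9) (rlit 0))
      (Seq (RSet (NLit 10) (rlit 0)) (NSet (NLit 0) (NLit 0))))))
  (Seq (for_loop NExperts (add_excess 9))
       (for_loop (NSub NExperts (NLit 1)) picking_body)).

Definition draw : cmd :=
  Seq (Sample (NLit 6))
      (If (TReal (RMul (rv 6) (RMem (NAdd (NLit 16) (nv 0))))
                 (RMem (NAdd (NAdd (NLit 16) NExperts) (nv 0))))
          Skip resample).

Definition algorithm : cmd :=
  Seq count_levels
  (Seq setup
  (Seq (While (nv 2) forever_test (Seq level_pass advance)) draw)).

Lemma repeat_trueP (R : realType) (Inv : nat -> state R -> Prop) k n f s :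
  Inv 0%N s -> (forall j t, (j < n)%N -> Inv j t -> Inv j.+1 (f (tick k t))) ->
  Inv n (repeat_while k n (fun=> true) f s).
Proof.
move=> I0 step; suff H m j t : (j + m <= n)%N -> Inv j t ->
    Inv (j + m)%N (repeat_while k m (fun=> true) f t) by apply: (H n 0%N).
elim: m j t => [|m IH] j t jm It; first by rewrite addn0.
by rewrite addnS -addSn /=; apply: IH; [lia | apply: step => //; lia].
Qed.

(** [f j] and [g j] describe the two memories after [j] iterations; the update of cell 3 is the
    increment that [for_loop] appends to the body. The clock is left to a separate analysis. *)
Lemma for_loopP (R : realType) (J : inputs R) (n : nexp) (c : cmd) (m : nat)
    (s : state R) (f : nat -> nat -> nat) (g : nat -> nat -> R) :
  (forall t : state R, neval J t n = m) ->
  f 0%N =1 upd (nmem s) 3 0%N -> g 0%N =1 rmem s ->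
  (forall j t, (j < m)%N -> nmem t =1 f j -> rmem t =1 g j -> coins t = coins s ->
     [/\ upd (nmem (exec J c t)) 3 (nmem (exec J c t) 3 + 1)%N =1 f j.+1,
         rmem (exec J c t) =1 g j.+1 & coins (exec J c t) = coins s]) ->
  let s' := exec J (for_loop n c) s in
  [/\ nmem s' =1 f m, rmem s' =1 g m & coins s' = coins s].
Proof.
move=> nm f0 g0 step /=; rewrite nm.
apply: (repeat_trueP
  (Inv := fun j t => [/\ nmem t =1 f j, rmem t =1 g j & coins t = coins s])).
  by split=> // a; rewrite ?f0 ?g0.
move=> j t jm [ft gt ct] /=.
by have [] := step j (tick 4 t) jm ft gt ct; split.
Qed.

(** * Correctness of the pieces of the program *)

Section LevelPass.
Variables (R : realType) (J : inputs R).
Implicit Types s : state R.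

Let N := in_experts J.
Let T := in_horizon J.
Let D := in_switch J.
Let l := in_loss J.

Let old_ s i := rmem s (16 + i)%N.
Let cur_ s i := rmem s (16 + N + i)%N.
Let wts_ s b i := rmem s (b + i)%N.

Lemma averaging_loopP s b : nmem s 4 = b -> (16 <= b)%N ->
  rmem s 1 = 0 -> rmem s 2 = 0 ->
  let s' := exec J (for_loop NExperts averaging_body) s in
  [/\ nmem s' =1 upd (nmem s) 3 N,
      rmem s' =1 upd (upd (rmem s) 1 (avg N l (old_ s))) 2 (mass N (wts_ s b)) &
      coins s' = coins s].
Proof.
move=> s4 b16 r1 r2.
apply: (for_loopP (J := J)
  (f := fun j => upd (nmem s) 3 j)
  (g := fun j => upd (upd (rmem s) 1 (avg j l (old_ s))) 2 (mass j (wts_ s b)))).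
- by [].
- by [].
- by move=> a; rewrite /upd /avg /mass !big_ord0; case: eqP => [->//|_]; case: eqP => [->|].
move=> j t jN ft gt ct.
have t3 : nmem t 3 = j by rewrite ft.
have t4 : nmem t 4 = b by rewrite ft.
split=> //=; first by move=> a; rewrite /upd t3 ft /upd; case: eqP => // _; lia.
move=> a; rewrite t3 t4 /upd !gt /upd /avg /mass !big_ord_recr /=.
have -> : (b + j == 1)%N = false by lia.
have -> : (b + j == 2)%N = false by lia.
by case: eqP => // _; case: eqP.
Qed.

(** After [j] iterations the first [j] cells of each block are new and the others untouched. The
    bound on [b] keeps the weights clear of the mixtures and the scratch cells. *)
Lemma growing_loopP s b : nmem s 4 = b -> (16 + N + N <= b)%N -> rmem s 3 = 0 ->
  let v := raw_weights N (rmem s 0) (4 * D * rmem s 0) (rmem s 0 / (N * T)%:R)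
             l (old_ s) (wts_ s b) in
  rmem s 1 = avg N l (old_ s) -> rmem s 2 = mass N (wts_ s b) ->
  let s' := exec J (for_loop NExperts growing_body) s in
  [/\ nmem s' =1 upd (nmem s) 3 N,
      rmem s' =1 (fun a => if a == 3 then mass N v else
        if (16 <= a < 16 + N)%N then mix N (wts_ s b) (old_ s) (a - 16)%N else
        if (b <= a < b + N)%N then v (a - b)%N else rmem s a) &
      coins s' = coins s].
Proof.
move=> s4 b16 r3 v r1 r2.
apply: (for_loopP (J := J)
  (f := fun j => upd (nmem s) 3 j)
  (g := fun j a => if a == 3 then mass j v else
        if (16 <= a < 16 + j)%N then mix N (wts_ s b) (old_ s) (a - 16)%N else
        if (b <= a < b + j)%N then v (a - b)%N else rmem s a)).
- by [].
- by [].
- move=> a /=; rewrite /mass big_ord0; case: eqP => [->//|_].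
  by rewrite !ifF //; lia.
move=> j t jN ft gt ct.
have t3 : nmem t 3 = j by rewrite ft.
have t4 : nmem t 4 = b by rewrite ft.
split=> //=; first by move=> a; rewrite /upd t3 ft /upd; case: eqP => // _; lia.
have g0 : rmem t 0 = rmem s 0 by rewrite gt /= !ifF //; lia.
have g1 : rmem t 1 = avg N l (old_ s) by rewrite gt /= !ifF //; lia.
have g2 : rmem t 2 = mass N (wts_ s b) by rewrite gt /= !ifF //; lia.
have g3 : rmem t 3 = mass j v by rewrite gt.
have gold : rmem t (16 + j)%N = old_ s j by rewrite gt /= !ifF //; lia.
have gw : rmem t (b + j)%N = wts_ s b j by rewrite gt /= !ifF //; lia.
have c1 : (b + j == 16 + j)%N = false by lia.
have c2 k : (k < 16)%N -> (k == 16 + j)%N = false by lia.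
have c3 k : (k < 16)%N -> (k == b + j)%N = false by lia.
move=> a; rewrite t3 t4 /upd ?c1 ?(c2 0%N isT) ?(c2 1%N isT) ?(c2 2%N isT) ?(c2 3%N isT)
  ?(c3 0%N isT) ?(c3 1%N isT) ?(c3 2%N isT) ?(c3 3%N isT) ?(c3 5%N isT) eqxx gold gw g0 g1 g2 g3.
have [a3|a3] := eqVneq a 3%N; first by rewrite /mass big_ord_recr.
have [->|ab] := eqVneq a (b + j)%N.
  by rewrite ifF ?ifT ?addKn//; lia.
have [->|ao] := eqVneq a (16 + j)%N; first by rewrite ifT ?addKn//; lia.
rewrite gt /= (negbTE a3).
have -> : (16 <= a < 16 + j.+1)%N = (16 <= a < 16 + j)%N by lia.
by have -> : (b <= a < b + j.+1)%N = (b <= a < b + j)%N by lia.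
Qed.

Lemma normalizing_loopP s b : nmem s 4 = b -> (16 + N + N <= b)%N ->
  let q i := wts_ s b i / rmem s 5 in
  let s' := exec J (for_loop NExperts normalizing_body) s in
  [/\ nmem s' =1 upd (nmem s) 3 N,
      rmem s' =1 (fun a =>
        if (16 + N <= a < 16 + N + N)%N then
          q (a - (16 + N))%N + (1 - rmem s 3 / rmem s 5) * rmem s a else
        if (b <= a < b + N)%N then q (a - b)%N else rmem s a) &
      coins s' = coins s].
Proof.
move=> s4 b16 q.
apply: (for_loopP (J := J)
  (f := fun j => upd (nmem s) 3 j)
  (g := fun j a =>
        if (16 + N <= a < 16 + N + j)%N then
          q (a - (16 + N))%N + (1 - rmem s 3 / rmem s 5) * rmem s a else
        if (b <= a < b + j)%N then q (a - b)%N else rmem s a)).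
- by [].
- by [].
- by move=> a /=; rewrite !ifF //; lia.
move=> j t jN ft gt ct.
have t3 : nmem t 3 = j by rewrite ft.
have t4 : nmem t 4 = b by rewrite ft.
split=> //=; first by move=> a; rewrite /upd t3 ft /upd; case: eqP => // _; lia.
have g3 : rmem t 3 = rmem s 3 by rewrite gt /= !ifF //; lia.
have g5 : rmem t 5 = rmem s 5 by rewrite gt /= !ifF //; lia.
have gcur : rmem t (16 + N + j)%N = rmem s (16 + N + j)%N.
  by rewrite gt /= !ifF //; lia.
have gw : rmem t (b + j)%N = wts_ s b j by rewrite gt /= !ifF //; lia.
have c1 : (16 + N + j == b + j)%N = false by lia.
have c3 k : (k < 16)%N -> (k == b + j)%N = false by lia.
move=> a; rewrite -/N t3 t4 /upd ?c1 ?(c3 0%N isT) ?(c3 1%N isT) ?(c3 2%N isT) ?(c3 3%N isT) ?(c3 5%N isT) eqxx gcur gw g3 g5.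
have [->|ao] := eqVneq a (16 + N + j)%N.
  by rewrite ifT ?addKn//; lia.
have [->|ab] := eqVneq a (b + j)%N.
  by rewrite ifF ?ifT ?addKn//; lia.
rewrite gt /=.
have -> : (16 + N <= a < 16 + N + j.+1)%N = (16 + N <= a < 16 + N + j)%N by lia.
by have -> : (b <= a < b + j.+1)%N = (b <= a < b + j)%N by lia.
Qed.

Local Ltac resolve_tests :=
  repeat (first [rewrite ifF; [|by lia] | rewrite ifT; [|by lia]]).

Lemma exec_seq c1 c2 s : exec J (Seq c1 c2) s = exec J c2 (exec J c1 s).
Proof. by []. Qed.

Lemma exec_if b c1 c2 s : exec J (If b c1 c2) s =
  exec J (if teval J s b then c1 else c2) (tick (tcost b).+1 s).
Proof. by []. Qed.

(** Two mixtures advance at once, one with the old and one with the new weights. The update is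
    driven by the mixture of the previous round, which is the one the revealed losses were played
    with. *)
Lemma level_passP s b : nmem s 4 = b -> (16 + N + N <= b)%N ->
  let q := wts_ s b in
  let q' := new_weights N (rmem s 0) (4 * D * rmem s 0)
              (rmem s 0 / (N * T)%:R) l (old_ s) q in
  let s' := exec J level_pass s in
  [/\ nmem s' =1 upd (nmem s) 3 N, coins s' = coins s, rmem s' 0 = rmem s 0,
      forall i, (i < N)%N -> [/\ old_ s' i = mix N q (old_ s) i,
        cur_ s' i = mix N q' (cur_ s) i & wts_ s' b i = q' i] &
      forall a, (16 + N + N <= a)%N -> ~~ (b <= a < b + N)%N ->
        rmem s' a = rmem s a].
Proof.
move=> s4 b16 q q'; rewrite /level_pass.
rewrite exec_seq; set s1 := exec J _ s.
rewrite exec_seq; set s2 := exec J _ s1.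
rewrite exec_seq; set s3 := exec J _ s2.
rewrite exec_seq; set s4' := exec J _ s3.
set s5 := exec J _ s4'.
have w1 : wts_ s1 b = q.
  apply/funext => i; rewrite /wts_ /s1 /= /upd.
  have c k : (k < 16)%N -> (b + i == k)%N = false by lia.
  by rewrite !c.
have o1 : old_ s1 = old_ s by [].
have [n2 g2 c2] : [/\ nmem s2 =1 upd (nmem s) 3 N,
    rmem s2 =1 upd (upd (rmem s1) 1 (avg N l (old_ s))) 2 (mass N q) &
    coins s2 = coins s].
  rewrite -o1 -w1; apply: (averaging_loopP (s := s1)) => //.
  by apply: leq_trans b16; rewrite -addnA leq_addr.
have w2 : wts_ s2 b = q.
  rewrite -w1; apply/funext => i; rewrite /wts_ g2 /upd.
  have c k : (k < 16)%N -> (b + i == k)%N = false by lia.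
  by rewrite !c.
have o2 : old_ s2 = old_ s by apply/funext => i; rewrite /old_ g2.
set v := raw_weights N (rmem s 0) (4 * D * rmem s 0) (rmem s 0 / (N * T)%:R)
             l (old_ s) q.
have [n3 g3 c3] : [/\ nmem s3 =1 upd (nmem s2) 3 N,
      rmem s3 =1 (fun a => if a == 3 then mass N v else
        if (16 <= a < 16 + N)%N then mix N q (old_ s) (a - 16)%N else
        if (b <= a < b + N)%N then v (a - b)%N else rmem s2 a) &
      coins s3 = coins s2].
  have r20 : rmem s2 0 = rmem s 0 by rewrite g2.
  have := @growing_loopP s2 b.
  rewrite w2 o2 r20; by apply=> //; rewrite ?n2 ?g2.
have rS : rmem s4' 5 = Num.max 1 (mass N v).
  rewrite /s4' exec_if /=.
  have -> : rmem s3 3 = mass N v by rewrite g3.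
  rewrite mulr1n /Order.max; case: (leP (mass N v) 1) => _ //=.
  by rewrite /upd /= g3.
have g4 a : a != 5 -> rmem s4' a = rmem s3 a.
  by move=> /negbTE a5; rewrite /s4' exec_if /=; case: ifP => _ /=; rewrite /upd a5.
have n4 : nmem s4' = nmem s3 by rewrite /s4' exec_if /=; case: ifP.
have c4 : coins s4' = coins s3 by rewrite /s4' exec_if /=; case: ifP.
have [n5 g5 c5] := @normalizing_loopP s4' b
  ltac:(by rewrite n4 n3 /upd n2 /upd) b16.
rewrite -/s5 in n5 g5 c5.
have qE i : (i < N)%N -> wts_ s4' b i / rmem s4' 5 = q' i.
  move=> iN; rewrite rS /q' /new_weights -/v; congr (_ / _).
  rewrite /wts_ g4 ?g3; last by lia.
  by resolve_tests; rewrite addKn.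
have mq' : mass N q' = mass N v / Num.max 1 (mass N v).
  by rewrite /q' /new_weights /mass -mulr_suml.
have r3 : rmem s4' 3 = mass N v by rewrite g4 ?g3.
split.
- by move=> a; rewrite n5 n4 /upd; case: eqP => // a3; rewrite n3 /upd; case: eqP => // _;
    rewrite n2 /upd; case: eqP.
- by rewrite c5 c4 c3 c2.
- by rewrite g5; resolve_tests; rewrite g4// g3; resolve_tests; rewrite g2.
- move=> i iN; split.
  + rewrite /old_ g5; resolve_tests; rewrite g4; last by lia.
    by rewrite g3; resolve_tests; rewrite addKn.
  + rewrite /cur_ g5; resolve_tests; rewrite addKn qE// /mix mq' r3 rS.
    rewrite g4; last by lia.
    by rewrite g3; resolve_tests; rewrite g2.
  + by rewrite /wts_ g5; resolve_tests; rewrite addKn qE.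
- move=> a aN ab; rewrite g5; resolve_tests.
  rewrite g4; last by lia.
  by rewrite g3; resolve_tests; rewrite g2 /s1 /= /upd; resolve_tests.
Qed.

Lemma clearing_loopP s :
  let s' := exec J (for_loop NExperts clearing_body) s in
  [/\ nmem s' =1 upd (nmem s) 3 N,
      rmem s' =1 (fun a => if (16 <= a < 16 + N + N)%N then 0 else rmem s a) &
      coins s' = coins s].
Proof.
have [n g c] : let s' := exec J (for_loop NExperts clearing_body) s in
  [/\ nmem s' =1 upd (nmem s) 3 N,
      rmem s' =1 (fun a => if (16 <= a < 16 + N)%N || (16 + N <= a < 16 + N + N)%N
        then 0 else rmem s a) & coins s' = coins s].
  apply: (for_loopP (J := J)
    (f := fun j => upd (nmem s) 3 j)
    (g := fun j a => if (16 <= a < 16 + j)%N || (16 + N <= a < 16 + N + j)%N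
        then 0 else rmem s a)).
  - by [].
  - by [].
  - by move=> a; rewrite ifF//; lia.
  move=> j t jN ft gt ct.
  have t3 : nmem t 3 = j by rewrite ft.
  split=> //=; first by move=> a; rewrite /upd t3 ft /upd; case: eqP => // _; lia.
  move=> a; rewrite -/N t3 /upd.
  have [->|a1] := eqVneq a (16 + N + j)%N; first by rewrite ifT//; lia.
  have [->|a2] := eqVneq a (16 + j)%N; first by rewrite ifT//; lia.
  rewrite gt /=; congr (if _ then _ else _).
  by lia.
split=> // a; rewrite g; congr (if _ then _ else _).
by lia.
Qed.

Lemma setupP s : (0 < N)%N -> let s' := exec J setup s in
  [/\ nmem s' =1 upd (upd (nmem s) 3 N) 4 (16 + N + N)%N, coins s' = coins s,
      rmem s' 0 = 1 / (2 * (D + 1) * (nmem s 1)%:R),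
      forall i, (i < N)%N -> old_ s' i = (i == 0%N)%:R /\ cur_ s' i = (i == 0%N)%:R &
      forall a, (16 + N + N <= a)%N -> rmem s' a = rmem s a].
Proof.
move=> N0; rewrite /setup.
rewrite exec_seq; set s1 := exec J _ s.
have [n1 g1 c1] : [/\ nmem s1 =1 upd (nmem s) 3 N,
      rmem s1 =1 (fun a => if (16 <= a < 16 + N + N)%N then 0 else rmem s a) &
      coins s1 = coins s] by exact: clearing_loopP.
rewrite /=; split.
- move=> a; rewrite /upd; case: eqP => // _; exact: n1.
- exact: c1.
- by rewrite /upd /= n1.
- move=> i iN; rewrite /old_ /cur_ /= /upd -/N.
  have -> : (16 + i == 16 + N)%N = false by lia.
  have -> : (16 + i == 16)%N = (i == 0)%N by lia.
  have -> : (16 + N + i == 16 + N)%N = (i == 0)%N by lia.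
  have -> : (16 + N + i == 16)%N = false by lia.
  rewrite !g1 /=; case: (i == 0)%N => //; split; rewrite ?ifT//; lia.
- move=> a aN; rewrite /= /upd -/N.
  have -> : (a == 0)%N = false by lia.
  have -> : (a == 16 + N)%N = false by lia.
  have -> : (a == 16)%N = false by lia.
  by rewrite g1 ifF//; lia.
Qed.

Lemma excess_loopP s : rmem s 9 = 0 ->
  let s' := exec J (for_loop NExperts (add_excess 9)) s in
  [/\ nmem s' =1 upd (nmem s) 3 N,
      rmem s' =1 upd (rmem s) 9 (cumul (old_ s) (cur_ s) N) &
      coins s' = coins s].
Proof.
move=> r9; apply: (for_loopP (J := J)
  (f := fun j => upd (nmem s) 3 j)
  (g := fun j => upd (rmem s) 9 (cumul (old_ s) (cur_ s) j))).
- by [].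
- by [].
- by move=> a; rewrite /upd /cumul big_ord0; case: eqP => // ->.
move=> j t jN ft gt ct.
have t3 : nmem t 3 = j by rewrite ft.
rewrite /add_excess exec_if /= -/N t3 !gt /= /upd.
have -> : (16 + N + j == 9)%N = false by lia.
rewrite /= cumulS /excess -/(cur_ s j) -/(old_ s j).
case: ifP => _ /=; split=> //.
- by move=> a; rewrite /= t3 ft /upd; case: eqP => // _; lia.
- by move=> a; rewrite gt /= /upd addr0.
- by move=> a; rewrite /= t3 ft /upd; case: eqP => // _; lia.
- move=> a; rewrite /= -/N t3 /upd !gt /upd.
  have -> : (16 + N + j == 9)%N = false by lia.
  by case: eqP.
Qed.

Lemma picking_loopP s x u :
  let P := old_ s in let Q := cur_ s in
  rmem s 7 = u * P x - Q x -> rmem s 8 = P x - Q x -> rmem s 9 = cumul P Q N ->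
  rmem s 10 = 0 -> nmem s 0 = 0%N ->
  let s' := exec J (for_loop (NSub NExperts (NLit 1)) picking_body) s in
  [/\ nmem s' =1 upd (upd (nmem s) 0 (pick_expert N P Q x u N.-1)) 3 N.-1,
      rmem s' =1 upd (rmem s) 10 (cumul P Q N.-1) &
      coins s' = coins s].
Proof.
move=> P Q r7 r8 r9 r10 n0; apply: (for_loopP (J := J)
  (f := fun j => upd (upd (nmem s) 0 (pick_expert N P Q x u j)) 3 j)
  (g := fun j => upd (rmem s) 10 (cumul P Q j))).
- by move=> t /=; rewrite subn1.
- by move=> a; rewrite /upd /=; case: eqP => // _; case: eqP => // ->.
- by move=> a; rewrite /upd /cumul big_ord0; case: eqP => // ->.
move=> j t jN ft gt ct.
have t3 : nmem t 3 = j by rewrite ft.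
rewrite /picking_body exec_seq; set t1 := exec J _ t.
have [n1 g1 c1] : [/\ nmem t1 =1 nmem t,
    rmem t1 =1 upd (rmem s) 10 (cumul P Q j.+1) & coins t1 = coins s].
  rewrite /t1 /add_excess exec_if /= -/N t3 !gt /= /upd.
  have e : (16 + N + j == 10)%N = false by lia.
  rewrite e /= cumulS /excess -/(cur_ s j) -/(old_ s j).
  case: ifP => _ /=; split=> //.
  - by move=> a; rewrite gt /= /upd addr0.
  - move=> a; rewrite /= -/N t3 /upd !gt /upd e.
    by case: eqP.
rewrite exec_if /= !g1 /upd /= r7 r8 r9 -/(crossed N P Q x u j).
case: ifP => _ /=; split=> //.
- move=> a; rewrite /upd !n1 ?t3 ?ft /upd /=.
  by case: eqP => // _; rewrite addn1.
- move=> a; rewrite /upd /= !n1 ?t3 ?ft /upd /=.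
  by case: eqP => [_|_]; [rewrite addn1 | case: eqP => // _; rewrite addn1].
Qed.

Lemma drawP s : let s' := exec J draw s in
  [/\ nmem s' 0 = next_expert N (old_ s) (cur_ s) (nmem s 0) (in_coin J (coins s)),
      coins s' = (coins s).+1 &
      forall a, (16 <= a)%N -> rmem s' a = rmem s a].
Proof.
set x := nmem s 0; set u := in_coin J (coins s).
have small a k : (16 <= a)%N -> (k < 16)%N -> (a == k)%N = false by lia.
rewrite /draw exec_seq; set s1 := exec J _ s.
rewrite exec_if /= /upd -/u -/x -/N.
have -> : (16 + N + x == 6)%N = false by lia.
rewrite /= /next_expert -/(old_ s x) -/(cur_ s x); case: ifP => _.
  by split=> // a a16 /=; rewrite /upd (small a 6).
rewrite /resample exec_seq; set s2 := exec J _ (tick _ s1).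
have o2 : old_ s2 = old_ s by [].
have u2 : cur_ s2 = cur_ s.
  apply/funext => i; rewrite /cur_ /s2 /= /upd.
  have e k : (k < 16)%N -> (16 + N + i == k)%N = false by lia.
  by rewrite !e.
have v7 : rmem s2 7 = u * old_ s x - cur_ s x.
  by rewrite /s2 /= /upd /= -/N -/x; resolve_tests.
have v8 : rmem s2 8 = old_ s x - cur_ s x.
  by rewrite /s2 /= /upd /= -/N -/x; resolve_tests.
have b2 a : (16 <= a)%N -> rmem s2 a = rmem s a.
  by move=> a16; rewrite /s2 /= /upd !(small a).
have n20 : nmem s2 0 = 0%N by [].
have c2 : coins s2 = (coins s).+1 by [].
have e9 : rmem s2 9 = 0 by [].
have e10 : rmem s2 10 = 0 by [].
move: s2 o2 u2 v7 v8 b2 n20 c2 e9 e10 => s2 o2 u2 v7 v8 b2 n20 c2 e9 e10.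
rewrite exec_seq; have [n3 g3 c3] := excess_loopP e9.
set s3 := exec J _ s2 in n3 g3 c3 *.
have o3 : old_ s3 = old_ s.
  by rewrite -o2; apply/funext => i; rewrite /old_ g3.
have u3 : cur_ s3 = cur_ s.
  rewrite -u2; apply/funext => i; rewrite /cur_ g3 /upd.
  by have -> : (16 + N + i == 9)%N = false by lia.
have [|||||n4 g4 c4] := @picking_loopP s3 x u.
- by rewrite o3 u3 g3.
- by rewrite o3 u3 g3.
- by rewrite o3 u3 g3 o2 u2.
- by rewrite g3.
- by rewrite n3.
rewrite o3 u3 in n4.
split.
- by rewrite n4.
- by rewrite c4 c3.
- by move=> a a16; rewrite g4 /upd (small a 10)// g3 /upd (small a 9)// b2.
Qed.

End LevelPass.

Lemma lt_levels (T j : nat) : (0 < T)%N -> (2 ^ j <= T)%N = (j < levels T)%N.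
Proof.
move=> T0; rewrite /levels ltnS; apply/idP/idP; first exact: trunc_log_max.
by move=> jT; apply: leq_trans (trunc_logP (isT : 1 < 2)%N T0); rewrite leq_exp2l.
Qed.

Lemma levels_le (T : nat) : (0 < T)%N -> (levels T <= T)%N.
Proof.
move=> T0; apply: leq_trans (trunc_logP (isT : 1 < 2)%N T0).
by rewrite /levels ltn_expl.
Qed.

(** * Dependence on the first [N] coordinates only, where memory and mathematical functions agree *)

Section Congruence.
Variables (R : realType) (N : nat).
Implicit Types P Q q l : nat -> R.

Lemma eq_mass q q' : (forall i, (i < N)%N -> q i = q' i) -> mass N q = mass N q'.
Proof. by move=> qq'; apply: eq_bigr => i _; rewrite qq'. Qed.

Lemma eq_avg l P P' : (forall i, (i < N)%N -> P i = P' i) -> avg N l P = avg N l P'.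
Proof. by move=> PP'; apply: eq_bigr => i _; rewrite PP'. Qed.

Lemma eq_mix q q' P P' i : (forall j, (j < N)%N -> q j = q' j) ->
  (forall j, (j < N)%N -> P j = P' j) -> (i < N)%N -> mix N q P i = mix N q' P' i.
Proof. by move=> qq' PP' iN; rewrite /mix (eq_mass qq') qq'// PP'. Qed.

Lemma eq_new_weights eta kappa share l q q' P P' i :
  (forall j, (j < N)%N -> q j = q' j) -> (forall j, (j < N)%N -> P j = P' j) ->
  (i < N)%N ->
  new_weights N eta kappa share l P q i = new_weights N eta kappa share l P' q' i.
Proof.
move=> qq' PP' iN; rewrite /new_weights.
have E j : (j < N)%N -> raw_weights N eta kappa share l P q j =
    raw_weights N eta kappa share l P' q' j.
  by move=> jN; rewrite /raw_weights (eq_avg _ PP') qq'.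
by rewrite (eq_mass E) E.
Qed.

Lemma eq_next_expert P P' Q Q' x u : (0 < N)%N ->
  (forall j, (j < N)%N -> P j = P' j) -> (forall j, (j < N)%N -> Q j = Q' j) ->
  (x < N)%N -> next_expert N P Q x u = next_expert N P' Q' x u.
Proof.
move=> N0 PP' QQ' xN; rewrite /next_expert PP'// QQ'//; case: ifP => // _.
have E n : (n <= N)%N -> cumul P Q n = cumul P' Q' n.
  move=> nN; apply: eq_bigr => i _; have iN := leq_trans (ltn_ord i) nN.
  by rewrite /excess PP'// QQ'.
suff H n : (n < N)%N -> pick_expert N P Q x u n = pick_expert N P' Q' x u n.
  by apply: H; rewrite prednK.
elim: n => //= n IH nN; rewrite /crossed !E//; last exact: ltnW.
by rewrite PP'// QQ'// IH// ltnW.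
Qed.

End Congruence.

(** * One full round: its effect and its running time *)

Section Round.
Variables (R : realType) (J : inputs R).
Implicit Types s : state R.

Local Notation N := (in_experts J).
Local Notation T := (in_horizon J).
Local Notation D := (in_switch J).

Hypotheses (N_gt0 : (0 < N)%N) (T_gt0 : (0 < T)%N).

Lemma exec_while n b c s : exec J (While n b c) s =
  repeat_while (tcost b).+1 (neval J s n) (fun t => teval J t b) (exec J c)
    (tick (ncost n).+1 s).
Proof. by []. Qed.

(** The time is tracked here as well, because the test stops the loop after [levels T - j]
    iterations, possibly far fewer than the bound [n]. *)
Lemma count_loopP n j s : nmem s 1 = (2 ^ j)%N -> nmem s 2 = j ->
  (j <= levels T <= j + n)%N ->
  let s' := repeat_while 5 n (fun t => teval J t (TNat (NMem (NLit 1)) NHorizon))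
    (exec J (Seq (NSet (NLit 1) (NMul (NLit 2) (NMem (NLit 1))))
                 (NSet (NLit 2) (NAdd (NMem (NLit 2)) (NLit 1))))) s in
  [/\ nmem s' 0 = nmem s 0, nmem s' 1 = (2 ^ levels T)%N, nmem s' 2 = levels T,
      rmem s' = rmem s &
      coins s' = coins s /\ (clock s' <= clock s + 17 * (levels T - j) + 5)%N].
Proof.
elim: n j s => [|n IH] j s h c /andP[j1 j2].
  have -> : j = levels T by lia.
  move: (h) (c); have -> : j = levels T by lia.
  by move=> h' c'; split=> //=; split=> //; rewrite -addnA leq_addr.
rewrite [repeat_while _ _ _ _ _]/= h lt_levels//.
case: ifP => jL; last first.
  have e : j = levels T by lia.
  by rewrite e in h c *; split=> //=; split=> //; lia.
set t := State _ _ _ _.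
have [|||i0 i1 i2 i3 [i4 i5]] := IH j.+1 t.
- by rewrite /t /= /upd /= ?h expnS.
- by rewrite /t /= /upd /= ?c addn1.
- by lia.
split=> //; split=> //.
by apply: leq_trans i5 _; rewrite /t /=; lia.
Qed.

Lemma count_levelsP s : let s' := exec J count_levels s in
  [/\ nmem s' 0 = nmem s 0, nmem s' 1 = (2 ^ levels T)%N, nmem s' 2 = levels T,
      rmem s' = rmem s &
      coins s' = coins s /\ (clock s' <= clock s + 17 * levels T + 20)%N].
Proof.
rewrite /count_levels exec_seq; set s1 := exec J _ s.
have L := levels_le T_gt0.
have [|||i0 i1 i2 i3 [i4 i5]] := @count_loopP T 0 (tick 2 s1).
- by [].
- by [].
- by rewrite add0n.
split=> //; split=> //; apply: leq_trans i5 _.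
by rewrite /s1 /=; lia.
Qed.

Definition weight_address d i := (16 + N + N + d * N + i)%N.

Lemma weight_address_neq d e i : d != e -> (i < N)%N ->
  ~~ (16 + N + N + e * N <= weight_address d i < 16 + N + N + e * N + N)%N.
Proof.
move=> de iN; have := de; rewrite neq_ltn /weight_address => /orP[h|h].
  have : (d.+1 * N <= e * N)%N by rewrite leq_mul2r h orbT.
  by rewrite mulSn => H; rewrite negb_and -!ltnNge; apply/orP; left; lia.
have : (e.+1 * N <= d * N)%N by rewrite leq_mul2r h orbT.
by rewrite mulSn => H; rewrite negb_and -!ltnNge; apply/orP; right; lia.
Qed.

Definition stored_weights (w : nat -> nat -> R) s :=
  forall d i, (d < levels T)%N -> (i < N)%N -> rmem s (weight_address d i) = w d i.

(** Invariant: the levels below [j] carry their new weights, and the two blocks hold the mixtures of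
    these levels for the old and for the new weights. *)
Lemma levels_loopP (w : nat -> nat -> R) s :
  let w' := next_weights N T D (in_loss J) w in
  nmem s 2 = levels T -> nmem s 4 = (16 + N + N)%N -> rmem s 0 = rate T D 0 ->
  (forall i, (i < N)%N -> rmem s (16 + i)%N = (i == 0%N)%:R /\
    rmem s (16 + N + i)%N = (i == 0%N)%:R) ->
  stored_weights w s ->
  let s' := exec J (While (NMem (NLit 2)) forever_test (Seq level_pass advance)) s in
  [/\ nmem s' 0 = nmem s 0, coins s' = coins s,
      forall i, (i < N)%N -> rmem s' (16 + i)%N = dist N w (levels T) i /\
        rmem s' (16 + N + i)%N = dist N w' (levels T) i &
      stored_weights w' s'].
Proof.
move=> w' s2 s4 s0 old0 sw.
pose Inv j t := [/\ nmem t 0 = nmem s 0, nmem t 4 = (16 + N + N + j * N)%N,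
  coins t = coins s, rmem t 0 = rate T D j &
  (forall i, (i < N)%N -> rmem t (16 + i)%N = dist N w j i /\
        rmem t (16 + N + i)%N = dist N w' j i) /\
  (forall d i, (d < levels T)%N -> (i < N)%N ->
     rmem t (weight_address d i) = if (d < j)%N then w' d i else w d i)].
suff : Inv (levels T) (exec J (While (NMem (NLit 2)) forever_test
    (Seq level_pass advance)) s).
  move=> [h0 _ hc _ [ho hw]]; split=> // d i dL iN.
  by rewrite hw// dL.
rewrite exec_while [neval _ _ _]s2.
apply: (repeat_trueP (Inv := Inv)); first by split=> //=; rewrite mul0n addn0.
move=> j t jL [t0 t4 tc tr [told tw]].
rewrite exec_seq.
have tw' : forall i, (i < N)%N -> rmem t (16 + N + N + j * N + i)%N = w j i.
  by move=> i iN; rewrite -/(weight_address j i) tw// ltnn.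
have [n1 c1 r1 v1 f1] := @level_passP R J (tick 4 t) (16 + N + N + j * N) t4
  (leq_addr _ _).
set t1 := exec J level_pass _ in n1 c1 r1 v1 f1 *.
have newE i : (i < N)%N -> new_weights N (rmem t 0) (4 * D * rmem t 0)
    (rmem t 0 / (N * T)%:R) (in_loss J) (fun i => rmem t (16 + i)%N)
    (fun i => rmem t (16 + N + N + j * N + i)%N) i = w' j i.
  move=> iN; rewrite tr /w' /next_weights /penalty /share.
  by apply: eq_new_weights => // k kN; have [] := told k kN.
have r1a a : a != 0%N -> rmem (exec J advance t1) a = rmem t1 a.
  by move=> /negbTE a0; rewrite /= /upd a0.
split.
- by rewrite /= /upd /= n1.
- by rewrite /= /upd /= n1 /upd /= t4 mulSn; lia.
- by rewrite /= c1.
- by rewrite /= /upd /= r1 tr rateS.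
split=> [i iN|d i dL iN]; rewrite !r1a//.
- have [vo vc vw] := v1 i iN; rewrite vo vc; split.
    by apply: eq_mix => // k kN; have [] := told k kN.
  by apply: eq_mix => [k|k kN|]//; [exact: newE | have [] := told k kN].
- have [->|dj] := eqVneq d j.
    by have [_ _ vw] := v1 i iN; rewrite ltnSn -newE.
  rewrite f1; last exact: weight_address_neq; last by rewrite /weight_address; lia.
  by rewrite tw// [(d < j.+1)%N]ltnS [(d <= j)%N]leq_eqVlt (negbTE dj).
Qed.

Lemma algorithmP (w : nat -> nat -> R) s :
  let w' := next_weights N T D (in_loss J) w in
  (nmem s 0 < N)%N -> stored_weights w s ->
  let s' := exec J algorithm s in
  [/\ nmem s' 0 = next_expert N (dist N w (levels T)) (dist N w' (levels T))
                    (nmem s 0) (in_coin J (coins s)),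
      coins s' = (coins s).+1 & stored_weights w' s'].
Proof.
move=> w' xN sw; rewrite /algorithm exec_seq.
have [n0 n1 n2 rE [cE _]] := count_levelsP s.
set s1 := exec J count_levels s in n0 n1 n2 rE cE *.
rewrite exec_seq; have [m1 d1 r0 i1 f1] := setupP s1 N_gt0.
set s2 := exec J setup s1 in m1 d1 r0 i1 f1 *.
rewrite exec_seq.
have [|||||k0 kc ko kw] := @levels_loopP w s2.
- by rewrite m1.
- by rewrite m1.
- by rewrite r0 n1 /rate expr0 mulr1.
- exact: i1.
- by move=> d i dL iN; rewrite f1 ?rE ?sw// /weight_address; lia.
set s3 := exec J (While _ _ _) s2 in k0 kc ko kw *.
have [e0 ec ef] := drawP J s3.
have e : nmem s3 0 = nmem s 0 by rewrite k0 m1 /upd /= n0.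
split.
- rewrite e0 e kc d1 cE; apply: eq_next_expert => // i iN; by have [] := ko i iN.
- by rewrite ec kc d1 cE.
- by move=> d i dL iN; rewrite ef ?kw// /weight_address; lia.
Qed.

(** A bound from every state, suited to code whose loop lengths are fixed by [N]. The loops of
    length [levels T] are timed separately. *)
Definition runs_in (c : cmd) (b : nat) :=
  forall s, (clock (exec J c s) <= clock s + b)%N.

Lemma runs_in_seq c1 c2 b1 b2 :
  runs_in c1 b1 -> runs_in c2 b2 -> runs_in (Seq c1 c2) (b1 + b2).
Proof.
by move=> h1 h2 s /=; apply: leq_trans (h2 _) _; rewrite addnA leq_add2r.
Qed.

Lemma runs_in_le c b b' : runs_in c b -> (b <= b')%N -> runs_in c b'.
Proof. by move=> h bb s; apply: leq_trans (h s) _; rewrite leq_add2l. Qed.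

Lemma runs_in_for n c m b : (forall s, neval J s n = m) -> runs_in c b ->
  runs_in (for_loop n c) (m * (b + 10) + ncost n + 4).
Proof.
move=> nm h s; rewrite /for_loop exec_seq exec_while [neval _ _ _]nm.
set s0 := tick _ _.
apply: leq_trans (_ : clock s0 + m * (b + 10) <= _)%N; last by rewrite /s0 /=; lia.
apply: (repeat_trueP (Inv := fun j t => clock t <= clock s0 + j * (b + 10))%N).
  by rewrite addn0.
move=> j t _; have := h (tick (tcost forever_test).+1 t); rewrite exec_seq [exec _ (NSet _ _) _]/= /= mulSn.
by move: (clock s0) => k H1 H2; lia.
Qed.

Lemma level_pass_time : runs_in level_pass (330 * N + 100).
Proof.
have H : runs_in level_pass (30 + (N * (100 + 10) + 1 + 4 + (N * (100 + 10) + 1 + 4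
    + (20 + (N * (100 + 10) + 1 + 4))))).
  apply: runs_in_seq; first by move=> s /=; lia.
  apply: runs_in_seq; first by apply: runs_in_for => // s /=; lia.
  apply: runs_in_seq; first by apply: runs_in_for => // s /=; lia.
  apply: runs_in_seq; last by apply: runs_in_for => // s /=; lia.
  by move=> s /=; case: ifP => _ /=; lia.
by apply: runs_in_le H _; lia.
Qed.

Lemma setup_time : runs_in setup (110 * N + 100).
Proof.
have H : runs_in setup (N * (100 + 10) + 1 + 4 + 50).
  apply: runs_in_seq; first by apply: runs_in_for => // s /=; lia.
  by move=> s /=; lia.
by apply: runs_in_le H _; lia.
Qed.

Lemma draw_time : runs_in draw (220 * N + 200).
Proof.
have H : runs_in resample (100 + (N * (100 + 10) + 1 + 4 + (N.-1 * (100 + 10) + 3 + 4))).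
  apply: runs_in_seq; first by move=> s /=; lia.
  apply: runs_in_seq.
    by apply: runs_in_for => // s; rewrite /add_excess exec_if; case: ifP => _ /=; lia.
  apply: runs_in_for => [s|s]; first by rewrite /= subn1.
  rewrite /picking_body exec_seq exec_if /add_excess exec_if.
  by case: ifP => _; case: ifP => _ /=; lia.
move=> s; rewrite /draw exec_seq exec_if; case: ifP => _; first by rewrite /=; lia.
by apply: leq_trans (H _) _; rewrite /=; lia.
Qed.

Lemma algorithm_time s :
  (clock (exec J algorithm s) <= clock s + 1200 * (N * levels T))%N.
Proof.
rewrite /algorithm exec_seq.
have [_ _ n2 _ [_ k1]] := count_levelsP s.
set s1 := exec J count_levels s in n2 k1 *.
rewrite exec_seq; have [m1 _ _ _ _] := setupP s1 N_gt0; have k2 := setup_time s1.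
set s2 := exec J setup s1 in m1 k2 *.
rewrite exec_seq; set s3 := exec J (While _ _ _) s2.
have k3 : (clock s3 <= clock s2 + 3 + levels T * (330 * N + 134))%N.
  have e2 : nmem s2 2 = levels T by rewrite m1.
  rewrite /s3 exec_while [neval _ _ _]e2.
  apply: (repeat_trueP
    (Inv := fun j t => clock t <= clock s2 + 3 + j * (330 * N + 134))%N).
    by rewrite mul0n addn0.
  have adv u : (clock (exec J advance u) <= clock u + 30)%N by rewrite /=; lia.
  move=> j t _ H; rewrite exec_seq mulSn.
  set t' := tick _ t.
  have B : (clock (exec J level_pass t') <= clock t + 4 + (330 * N + 100))%N.
    exact: level_pass_time t'.
  apply: leq_trans (adv _) _; move: (exec J level_pass t') B => v B.
  by lia.
have k4 := draw_time s3.
have L1 : (0 < levels T)%N by [].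
have NL1 : (N <= N * levels T)%N by rewrite leq_pmulr.
have NL2 : (levels T <= N * levels T)%N by rewrite leq_pmull.
have e : (levels T * (330 * N + 134) = 330 * (N * levels T) + 134 * levels T)%N.
  by rewrite mulnDr mulnCA [(levels T * N)%N]mulnC [(levels T * 134)%N]mulnC.
rewrite e in k3.
move: (N * levels T)%N NL1 NL2 k3 => NL NL1 NL2 k3.
by lia.
Qed.

End Round.

(** * The run of the program *)

Section Run.
Variables (R : realType) (N T : nat) (D : R).
Hypotheses (N_gt0 : (0 < N)%N) (T_gt0 : (0 < T)%N) (D_ge0 : 0 <= D).

Lemma dist_zero d i : dist N (fun _ _ => 0 : R) d i = (i == 0%N)%:R.
Proof.
elim: d i => //= d IH i; rewrite /mix IH add0r /mass big1//.
by rewrite subr0 mul1r.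
Qed.

Lemma play0 (ell : nat -> nat -> R) i : play N T D ell 0 i = (i == 0%N)%:R.
Proof. exact: dist_zero. Qed.

Lemma runS (l : nat -> 'I_N -> R) (u : nat -> R) t :
  run algorithm T D l u t.+1 = exec (Inputs N T D (last_loss l t) u) algorithm
    (reset_clock (run algorithm T D l u t)).
Proof. by []. Qed.

(** One coin is drawn per round, so the coin counter equals the round and the program follows [walk]
    coin by coin. *)
Lemma runP (l : nat -> 'I_N -> R) (u : nat -> R) t :
  let s := run algorithm T D l u t in
  [/\ nmem s 0 = walk N (play N T D (last_loss l)) u t, coins s = t &
      forall d i, (d < levels T)%N -> (i < N)%N ->
        rmem s (16 + N + N + d * N + i)%N = weights N T D (last_loss l) t d i].
Proof.
elim: t => [|t IH]; first by split.
rewrite runS; case: IH; set s := run algorithm T D l u t => n0 ct sw.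
set J := Inputs N T D (last_loss l t) u.
have xN : (nmem (reset_clock s) 0 < in_experts J)%N by rewrite n0 walk_lt.
have [e0 ec ew] := @algorithmP R J N_gt0 T_gt0 (weights N T D (last_loss l) t)
  (reset_clock s) xN sw.
by split; [rewrite e0 n0 ct | rewrite ec ct | exact: ew].
Qed.

Lemma chosen_expertP (l : nat -> 'I_N -> R) (u : nat -> R) t :
  val (chosen_expert algorithm N_gt0 T D l u t) =
  walk N (play N T D (last_loss l)) u t.
Proof.
rewrite /chosen_expert; have [-> _ _] := runP l u t.
by rewrite val_insubd walk_lt.
Qed.

(** As [ln 2 >= 1/2], both the truncated logarithm and the one extra level are at most
    [2 ln (T + 1)]. With [T + 1] this holds for [T = 1] too. *)
Lemma levels_le_ln : (levels T)%:R <= 4 * ln (T + 1)%:R :> R.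
Proof.
have T1 : 0 < T%:R :> R by rewrite ltr0n.
have h1 : (trunc_log 2 T)%:R * ln 2 <= ln (T + 1)%:R :> R.
  rewrite mulr_natl -lnXn// ler_ln ?posrE ?exprn_gt0// ?ltr0n ?addn1//.
  rewrite -natrX ler_nat; apply: leqW.
  exact: trunc_logP.
have h2 : ln 2 <= ln (T + 1)%:R :> R.
  by rewrite ler_ln ?posrE ?ltr0n ?addn1// ler_nat ltnS.
have h3 := ln2_ge R; rewrite /levels -natr1.
have : (trunc_log 2 T)%:R * (1 / 2) <= (trunc_log 2 T)%:R * ln 2 :> R.
  by rewrite ler_wpM2l.
by lra.
Qed.

Lemma round_time_le (l : nat -> 'I_N -> R) (u : nat -> R) t : (0 < t)%N ->
  (round_time algorithm T D l u t)%:R <= 4800 * (N%:R * ln (T + 1)%:R) :> R.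
Proof.
case: t => // t _; rewrite /round_time runS.
set J := Inputs N T D (last_loss l t) u.
have := @algorithm_time R J N_gt0 T_gt0 (reset_clock (run algorithm T D l u t)).
rewrite -(ler_nat R) => /le_trans; apply.
rewrite add0n !natrM.
have h : N%:R * (levels T)%:R <= N%:R * (4 * ln (T + 1)%:R) :> R.
  by rewrite ler_wpM2l// levels_le_ln.
by lra.
Qed.

(** Losses are known to lie in [0, 1] only at steps 1 to [T], while the analysis of the levels
    assumes it at all times. *)
Definition clip (l : nat -> 'I_N -> R) : nat -> 'I_N -> R :=
  fun t i => if (1 <= t <= T)%N then l t i else 0.

Lemma clip01 l t i : loss_sequence T l -> 0 <= clip l t i <= 1.
Proof. by move=> ll; rewrite /clip; case: ifP => [/ll|_] //; rewrite lexx ler01. Qed.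

Lemma last_loss01 l t j : loss_sequence T l -> 0 <= last_loss (clip l) t j <= 1.
Proof.
move=> ll; rewrite /last_loss; case: t => [|t]; first by rewrite lexx ler01.
by case: insubP => [i _ _|_]; [exact: clip01 | rewrite lexx ler01].
Qed.

Lemma last_loss_ord (l : nat -> 'I_N -> R) t (i : 'I_N) : (0 < t)%N ->
  last_loss l t i = l t i.
Proof. by case: t => // t _; rewrite /last_loss valK. Qed.

(** Round [t] reads losses only up to step [t - 1 <= T]. *)
Lemma run_clip (l : nat -> 'I_N -> R) u t : (t <= T.+1)%N ->
  run algorithm T D l u t = run algorithm T D (clip l) u t.
Proof.
elim: t => [|t IH] tT; first by [].
rewrite !runS -(IH (ltnW tT)).
suff -> : last_loss (clip l) t = last_loss l t by [].
apply/funext => j; rewrite /last_loss; case: t tT {IH} => // t tT.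
by case: insubP => // i _ _; rewrite /clip ifT.
Qed.

Lemma interval_cost_clip (l : nat -> 'I_N -> R) u t0 k : (t0 + k <= T)%N ->
  interval_cost D l (chosen_expert algorithm N_gt0 T D l u) t0 k =
  interval_cost D (clip l) (chosen_expert algorithm N_gt0 T D (clip l) u) t0 k.
Proof.
move=> kT; have xE t : (t <= T)%N -> chosen_expert algorithm N_gt0 T D l u t =
    chosen_expert algorithm N_gt0 T D (clip l) u t.
  by move=> tT; rewrite /chosen_expert run_clip// leqW.
rewrite /interval_cost !big_nat; congr (_ + _ * _); apply: eq_bigr => t tk.
  by rewrite xE ?/clip ?ifT//; lia.
by rewrite !xE//; lia.
Qed.

Lemma expected_regret (l : nat -> 'I_N -> R) (i : 'I_N) t0 k :
  loss_sequence T l -> (t0 + k <= T)%N ->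
  \sum_(t0 + 1 <= t < t0 + k + 1)
    \sum_(j < N) clip l t j * play N T D (last_loss (clip l)) t j
  + D * \sum_(t0 + 2 <= t < t0 + k + 1)
      (l1dist N (play N T D (last_loss (clip l)) t)
                (play N T D (last_loss (clip l)) t.-1) / 2) <=
  \sum_(t0 + 1 <= t < t0 + k + 1) clip l t i
  + 100 * Num.sqrt ((D + 1) * k%:R * ln (N * T)%:R).
Proof.
move=> ll kT; set ell := last_loss (clip l); set pi := play N T D ell.
have ell01 t j : 0 <= ell t j <= 1 by exact: last_loss01.
have kT' : (k <= T)%N by lia.
have lossE j : \sum_(t0 + 1 <= t < t0 + k + 1) clip l t j =
    \sum_(t0.+1 <= t < t0.+1 + k) ell t j.
  rewrite addn1 addn1 -addSn !big_nat; apply: eq_bigr => t /andP[t1 _].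
  by rewrite /ell last_loss_ord//; lia.
(* For [N = T = 1] the logarithm vanishes, but there is a single expert, and no switch is
   charged. *)
have [NT1|NT1] := leqP (N * T) 1.
  have N1 : N = 1%N by nia.
  have T1 : T = 1%N by nia.
  rewrite [X in D * X]big_geq ?mulr0 ?addr0; last by lia.
  apply: le_trans (_ : \sum_(t0 + 1 <= t < t0 + k + 1) clip l t i <= _); last first.
    by rewrite lerDl mulr_ge0 ?sqrtr_ge0.
  apply: ler_sum => t _.
  have [p0 p1] : distr N (pi t) by exact: distr_weights.
  rewrite -[leRHS]mulr1 -p1 /mass mulr_sumr; apply: ler_sum => j _.
  suff -> : i = j by [].
  apply: val_inj; case: i j => [i iN] [j jN] /=.
  by move: iN jN; rewrite N1 !ltnS !leqn0 => /eqP -> /eqP ->.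
rewrite lossE.
apply: le_trans (regret_bound N_gt0 T_gt0 D_ge0 ell01 i (ltn0Sn t0) kT' NT1).
rewrite /total_cost big_split /=; apply: lerD.
  rewrite addn1 addn1 -addSn !big_nat; apply: ler_sum => t /andP[t1 _].
  by apply: ler_sum => j _; rewrite /ell last_loss_ord//; lia.
rewrite mulr_sumr.
case: k kT kT' {lossE} => [|k] kT kT'; first by rewrite !big_geq//; lia.
have -> : (t0 + k.+1 + 1 = (t0.+1 + k).+1)%N by lia.
have -> : (t0 + 2 = t0.+2)%N by lia.
(* The switch into step [t + 1] is charged to the movement after step [t]; the movement after the
   last step is nonnegative and dropped. *)
rewrite [X in X <= _]big_add1 /= addnS [X in _ <= X]big_nat_recr ?leq_addr//=.
have m0 t : 0 <= D * \sum_(0 <= j < levels T) movement N T D ell t j.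
  rewrite mulr_ge0// big_mkord; apply: sumr_ge0 => j _.
  exact: movement_ge0.
apply: le_trans (_ : \sum_(t0.+1 <= t < t0.+1 + k)
   D * \sum_(0 <= j < levels T) movement N T D ell t j <= _); last by rewrite lerDl.
apply: ler_sum => t _; rewrite ler_wpM2l// ler_pdivrMr// mulrC big_mkord.
exact: l1dist_dist.
Qed.

End Run.

Theorem theorem2p1 (R : realType) :
  exists2 C : R, 0 < C & exists (A : cmd) (K : R),
  forall (N T : nat) (D : R) (hN : (0 < N)%N), (0 < T)%N -> 0 <= D ->
    (forall (l : nat -> 'I_N -> R) (u : nat -> R) (t : nat),
       loss_sequence T l -> (forall j, 0 <= u j <= 1) -> (1 <= t <= T)%N ->
       (round_time A T D l u t)%:R <= K * (N%:R * ln (T + 1)%:R))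
    /\
    (forall (d : measure_display) (W : measurableType d) (P : probability W R)
            (U : nat -> {RV P >-> R}), iid_uniform01 U ->
     forall t0 k : nat, (t0 + k <= T)%N ->
       (regret P T D (fun l w => chosen_expert A hN T D l (fun j => U j w)) t0 k
        <= (C * Num.sqrt ((D + 1) * k%:R * ln (N * T)%:R))%:E)%E).
Proof.
exists 100 => //; exists algorithm, 4800 => N T D hN T0 D0; split.
  by move=> l u t _ _ /andP[t0 _]; exact: round_time_le.
move=> d W P U Uiid t0 k kT; apply: ereal_inf_lbound.
exists (100 * Num.sqrt ((D + 1) * k%:R * ln (N * T)%:R)) => //= l ll.
set r := 100 * _.
under [X in ('E_P[X] <= _)%E]eq_fun do rewrite interval_cost_clip//.
(* Being a lower bound is stable under minimum, so each expert can be treated alone. *)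
rewrite -leeBlDr//; elim/big_ind: _ => [|x y xE yE|i _].
- exact: leey.
- by rewrite le_min xE yE.
rewrite leeBlDr// -EFinD.
have pid t : distr N (play N T D (last_loss (clip T l)) t).
  apply: distr_weights => // t' j; exact: last_loss01.
apply: le_trans (expected_cost_le hN pid (play0 N T D _) Uiid t0 k D0 _ _) _.
- by move=> t j; have /andP[] := clip01 t j ll.
- by move=> w t; exact: chosen_expertP.
rewrite lee_fin; apply: le_trans (expected_regret hN T0 D0 i ll kT) _.
rewrite lerD2r !big_nat; apply: ler_sum => t tk.
by rewrite /clip ifT//; lia.
Qed.
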